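(* Let $n$ and $r$ be integers with $2\leq n\leq 5$ and $r\geq n$. Then the Vietoris--Rips complex $\mathrm{VR}(\mathbb{Z}^n;r)$ is contractible.
   Context: $\mathbb{Z}^n$ is equipped with the Manhattan (word) metric $d(x,y)=\sum_{i=1}^n |x_i-y_i|$. For a metric space $X$ and $r\geq 0$, $\mathrm{VR}(X;r)$ is the simplicial complex with vertex set $X$ whose simplices are the finite subsets of $X$ of diameter at most $r$. *)

(* Defs.v *)
From mathcomp Require Import all_boot all_order all_algebra.
From mathcomp Require Import Rstruct.
From Stdlib Require Import Rdefinitions.

Set Implicit Arguments.
Unset Strict Implicit.
Unset Printing Implicit Defensive.

Import Order.TTheory GRing.Theory Num.Theory.
Local Open Scope ring_scope.

Definition Zn (n : nat) := {ffun 'I_n -> int}.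

Definition l1dist (n : nat) (x y : Zn n) : nat :=
  (\sum_(i < n) absz (x i - y i))%N.

Definition VR_simplex (n r : nat) (s : seq (Zn n)) : Prop :=
  uniq s /\ forall x y, x \in s -> y \in s -> leq (l1dist x y) r.

(* Geometric realization |VR(Z^n; r)| : points are barycentric coordinate
   functions  p : Z^n -> Rdefinitions.R,  nonnegative, summing to 1, supported on a
   simplex. *)
Definition VR_point (n r : nat) (p : Zn n -> Rdefinitions.R) : Prop :=
  exists s : seq (Zn n),
    [/\ VR_simplex r s,
        (forall v, v \notin s -> p v = 0),
        (forall v, 0 <= p v) &
        \sum_(v <- s) p v = 1].

(* Sup-distance closeness between points of the realization (the metric
   topology; VR(Z^n;r) is locally finite and finite dimensional, so this
   topology coincides with the usual weak topology). *)
Definition close (n : nat) (d : Rdefinitions.R) (p q : Zn n -> Rdefinitions.R) : Prop :=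
  forall v, `|p v - q v| < d.

Definition VR_contractible (n r : nat) : Prop :=
  exists (H : (Zn n -> Rdefinitions.R) -> Rdefinitions.R -> (Zn n -> Rdefinitions.R)) (c : Zn n -> Rdefinitions.R),
    [/\ VR_point r c,
        (forall p t, VR_point r p -> 0 <= t <= 1 -> VR_point r (H p t)),
        (forall p, VR_point r p -> H p 0 = p),
        (forall p, VR_point r p -> H p 1 = c) &
        (forall p t, VR_point r p -> 0 <= t <= 1 ->
           forall eps : Rdefinitions.R, 0 < eps -> exists2 delta : Rdefinitions.R, 0 < delta &
             forall q s, VR_point r q -> 0 <= s <= 1 ->
               close delta p q -> `|t - s| < delta ->
               close eps (H p t) (H q s))].

(* Main.v *)
(* The complex is dismantled from infinity inwards. The lattice points are swept
   out by boxes that grow one coordinate face at a time; among the simplices lying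
   in the outermost face [x_i = N], the largest are removed first. When the turn of
   such a simplex [S] comes, the part of its link that is left lives in
   [x_i < N], and it is a cone as soon as some lattice point [w] of the face
   satisfies [d(w, s) <= r - 1] for all [s] in [S], and [d(z, w) <= k + 1] whenever
   [d(z, s) <= k] for all [s] in [S]: the apex is [w] moved by one inside the box.
   Such a centre [w] exists in dimension [n - 1 <= 4] for [r >= n]. If no two points
   of [S] are at distance [r], any point of [S] works. If [r >= 8], elimination of
   variables gives a real point in the hull of [S] within [3r/4] of [S], and rounding
   its four coordinates moves it by at most [2]. The remaining [r <= 7] are settled
   by a finite search. Each removal is realised by pushing mass to the apex, and the
   pushes are performed one after the other in intervals accumulating at time [0];
   near a given point only finitely many of them have any effect. *)
From Stdlib Require Import ZArith Lia ClassicalEpsilon FunctionalExtensionality.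
Require Import Defs.
From mathcomp Require Import all_boot all_order all_algebra finmap.
From mathcomp Require Import Rstruct ring lra zify ssrZ.

Set Implicit Arguments.
Unset Strict Implicit.
Unset Printing Implicit Defensive.

Import Order.TTheory GRing.Theory Num.Theory.

(** * Centres of simplices in dimension at most four *)

Section FourSpace.
Local Open Scope Z_scope.

Definition Z4 := (Z * Z * Z * Z)%type.

Definition dist4 (x y : Z4) : Z :=
  let: (x1, x2, x3, x4) := x in let: (y1, y2, y3, y4) := y in
  Z.abs (x1 - y1) + Z.abs (x2 - y2) + Z.abs (x3 - y3) + Z.abs (x4 - y4).

(* [(b, s)] encodes the functional [+-(x + y)] ([b = true]) or [+-(x - y)]. *)
Definition planar (a : bool * bool) (x y : Z) : Z :=
  let t := if a.1 then x + y else x - y in if a.2 then t else - t.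

Definition opp_planar (a : bool * bool) := (a.1, ~~ a.2).

Definition signed_sum (a b : bool * bool) (x : Z4) : Z :=
  let: (x1, x2, x3, x4) := x in planar a x1 x2 + planar b x3 x4.

Lemma signed_sum_opp a b x :
  signed_sum (opp_planar a) (opp_planar b) x = - signed_sum a b x.
Proof.
case: x => [[[x1 x2] x3] x4]; case: a => [[] []]; case: b => [[] []];
  rewrite /signed_sum /planar /=; lia.
Qed.

Lemma signed_sum_le_dist4 a b x y :
  signed_sum a b x - signed_sum a b y <= dist4 x y.
Proof.
case: x => [[[x1 x2] x3] x4]; case: y => [[[y1 y2] y3] y4].
case: a => [[] []]; case: b => [[] []];
  rewrite /signed_sum /planar /dist4 /=; lia.
Qed.

Lemma dist4_signed_sum x y :
  exists a b, dist4 x y = signed_sum a b x - signed_sum a b y.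
Proof.
case: x => [[[x1 x2] x3] x4]; case: y => [[[y1 y2] y3] y4].
have planarP (s t : Z) : exists a : bool * bool, Z.abs s + Z.abs t = planar a s t.
  have [s0|s0] := Z.leb_spec 0 s; have [t0|t0] := Z.leb_spec 0 t.
  - exists (true, true); rewrite /planar /=; lia.
  - exists (false, true); rewrite /planar /=; lia.
  - exists (false, false); rewrite /planar /=; lia.
  - exists (true, false); rewrite /planar /=; lia.
have [a aE] := planarP (x1 - y1) (x2 - y2).
have [b bE] := planarP (x3 - y3) (x4 - y4).
exists a, b; move: aE bE; rewrite /signed_sum /dist4.
by case: a => [[] []]; case: b => [[] []]; rewrite /planar /=; lia.
Qed.

Lemma dist4C x y : dist4 x y = dist4 y x.
Proof.
case: x => [[[x1 x2] x3] x4]; case: y => [[[y1 y2] y3] y4] /=; lia.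
Qed.

(** The bound [k] is left arbitrary: for a point off the hyperplane of the simplex it will be what
    its distance to the hyperplane leaves of the radius. *)
Definition centered (r : Z) (s : seq Z4) (w : Z4) : Prop :=
  (forall x : Z4, x \in s -> dist4 w x <= r - 1) /\
  (forall z k, (forall x : Z4, x \in s -> dist4 z x <= k) -> dist4 z w <= k + 1).

(** The Manhattan distance is the maximum of the sixteen functionals [signed_sum a b] on the
    difference. If one of them computes [dist4 z w], a point [x] on which the opposite functional
    is, up to 1, at least its value at [w] is as far from [z] as [w], up to 1. *)
Lemma hull_centered (r : Z) (s : seq Z4) (w : Z4) :
  (forall x : Z4, x \in s -> dist4 w x <= r - 1) ->
  (forall a b, exists2 x, x \in s & signed_sum a b w <= signed_sum a b x + 1) ->
  centered r s w.
Proof.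
move=> near hull; split=> // z k zk.
have [a [b ->]] := dist4_signed_sum z w.
have [x xs] := hull (opp_planar a) (opp_planar b).
rewrite !signed_sum_opp => wx.
have := zk x xs; have := @signed_sum_le_dist4 a b z x; lia.
Qed.

Definition signs : seq (bool * bool) :=
  [:: (true, true); (true, false); (false, true); (false, false)].

Definition hull_ok (S : seq Z4) (w : Z4) : bool :=
  all (fun a => all (fun b =>
    let t := signed_sum a b w - 1 in
    has (fun x => t <=? signed_sum a b x) S) signs) signs.

(** Choosing the candidate with the fewest spoiling points keeps the branching of [search] small. *)
Fixpoint best_centre (r : Z) (cand : seq Z4) (S W : seq Z4)
    (best : option (Z4 * seq Z4)) : option (Z4 * seq Z4) :=
  if W is w :: W' then
    if hull_ok S w then
      let bad := [seq x <- cand | r <=? dist4 w x] in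
      if bad is [::] then Some (w, bad) else
      best_centre r cand S W'
        (if best is Some (w', bad') then
           if ltn (size bad) (size bad') then Some (w, bad) else best
         else Some (w, bad))
    else best_centre r cand S W' best
  else best.

(* Depth-first search for a centre of all diameter-[r] supersets of [S] with
   points in [S ++ cand]: a candidate centre [w] can only be spoiled by a point
   at distance at least [r] from [w], and each such point is added to [S]. *)
Fixpoint search (fuel : nat) (r : Z) (S cand W : seq Z4) : bool :=
  if fuel is fuel'.+1 then
    if best_centre r cand S W None is Some (_, bad) then
      all (fun x => search fuel' r (x :: S)
             [seq y <- cand | dist4 x y <=? r]
             [seq w <- W | dist4 w x <? r]) bad
    else false
  else false.

Lemma hull_okP S w : hull_ok S w ->
  forall a b, exists2 x, x \in S & signed_sum a b w <= signed_sum a b x + 1.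
Proof.
move=> /allP ok a b.
have aS : a \in signs by case: a => [[] []].
have bS : b \in signs by case: b => [[] []].
have /hasP [x xS /Z.leb_le] := allP (ok a aS) b bS.
by exists x => //; lia.
Qed.

Lemma best_centreP r cand S W best w bad :
  (forall w' bad', best = Some (w', bad') ->
     [/\ hull_ok S w', (forall x : Z4, x \in S -> dist4 w' x <= r - 1) &
         bad' = [seq x <- cand | r <=? dist4 w' x]]) ->
  (forall w' x, w' \in W -> x \in S -> dist4 w' x <= r - 1) ->
  best_centre r cand S W best = Some (w, bad) ->
  [/\ hull_ok S w, (forall x : Z4, x \in S -> dist4 w x <= r - 1) &
      bad = [seq x <- cand | r <=? dist4 w x]].
Proof.
elim: W best => [|w1 W IH] best bestP WP /=; first exact: bestP.
have W'P w' x : w' \in W -> x \in S -> dist4 w' x <= r - 1.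
  by move=> w'W; apply: WP; rewrite inE w'W orbT.
case: ifPn => [ok|_]; last exact: IH.
have w1P x : x \in S -> dist4 w1 x <= r - 1 by apply: WP; rewrite mem_head.
case E : [seq x <- cand | r <=? dist4 w1 x] => [|y l].
  by case=> <- <-; split.
apply: IH => // w' bad'; case: best bestP => [[w2 bad2]|] bestP.
  case: ifP => _; first by case=> <- <-; rewrite -E.
  by move=> [<- <-]; apply: bestP.
by case=> <- <-; rewrite -E.
Qed.

(** The set [s] is followed down one branch. If a point of [s] is at distance at least [r] from the
    chosen [w], it belongs to [cand] and the search that adds it to [S] succeeds; otherwise [w] is a
    centre. Exhausted fuel gives [false], so the depth bound is harmless. *)
Lemma search_sound fuel r S cand W (s : seq Z4) :
  (forall w x, w \in W -> x \in S -> dist4 w x <= r - 1) ->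
  search fuel r S cand W ->
  {subset S <= s} -> (forall x : Z4, x \in s -> (x \in S) || (x \in cand)) ->
  (forall x y : Z4, x \in s -> y \in s -> dist4 x y <= r) ->
  exists w, centered r s w.
Proof.
elim: fuel S cand W => [|fuel IH] //= S cand W WP.
case E : best_centre => [[w bad]|] // /allP bad_ok Ss sS diam.
have [//|/hull_okP ok wS badE] := @best_centreP r cand S W None w bad _ WP E.
have [/hasP[x xs xfar]|/hasPn near] := boolP (has (fun x => r <=? dist4 w x) s).
  have xcand : x \in cand.
    have /orP[/wS xS|//] := sS x xs; move: xfar => /Z.leb_le; lia.
  apply: (IH _ _ _ _ (bad_ok x _)).
  - move=> w' y; rewrite mem_filter inE => /andP[/Z.ltb_lt w'x w'W] /orP[/eqP->|yS].
      lia.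
    exact: WP.
  - by rewrite badE mem_filter xfar.
  - by move=> y; rewrite inE => /orP[/eqP->|/Ss].
  - move=> y ys; rewrite inE mem_filter.
    have /orP[->|->] := sS y ys; rewrite ?orbT //= andbT.
    by have /Z.leb_le -> := diam _ _ xs ys; rewrite orbT.
  - exact: diam.
exists w; apply: hull_centered.
  move=> x xs; have := near x xs; move=> /Z.leb_spec0; lia.
by move=> a b; have [x xS] := ok a b; exists x => //; apply: Ss.
Qed.

End FourSpace.

(** * Finite search for small radii *)

Section SmallScale.
Local Open Scope Z_scope.

Definition Zrange (lo : Z) (k : nat) : seq Z := [seq lo + Z.of_nat i | i <- iota 0 k].

Definition grid (A B C D : seq Z) : seq Z4 :=
  [seq (t, d) | t <- [seq (t, c) | t <- [seq (a, b) | a <- A, b <- B], c <- C], d <- D].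

Definition origin : Z4 := (0, 0, 0, 0).

(** Candidate centres range over the box spanned by [origin] and [a], widened to -1, 0, 1 in the
    directions below [m] where [a] vanishes. The depth 9 is a cap that computation shows sufficient
    for the cases of [small_scales]. *)
Definition search_from (m r : nat) (a : Z4) : bool :=
  let rZ := Z.of_nat r in
  let ball k := if (k < m)%nat then Zrange (- rZ) (2 * r).+1 else [:: 0] in
  let mid k x := if x =? 0 then if (k < m)%nat then [:: -1; 0; 1] else [:: 0]
                 else Zrange 0 (Z.to_nat x).+1 in
  let: (a1, a2, a3, a4) := a in
  search 9 rZ [:: origin; a]
    [seq z <- grid (ball 0%nat) (ball 1%nat) (ball 2%nat) (ball 3%nat)
       | (dist4 origin z <=? rZ) && (dist4 a z <=? rZ)]
    [seq w <- grid (mid 0%nat a1) (mid 1%nat a2) (mid 2%nat a3) (mid 3%nat a4)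
       | (dist4 w origin <? rZ) && (dist4 w a <? rZ)].

Definition directions (m r : nat) : seq Z4 :=
  let rng k := if (k < m)%nat then Zrange 0 r.+1 else [:: 0] in
  [seq a <- grid (rng 0%nat) (rng 1%nat) (rng 2%nat) (rng 3%nat)
     | let: (a1, a2, a3, a4) := a in
       [&& a1 + a2 + a3 + a4 =? Z.of_nat r, a2 <=? a1, a3 <=? a2 & a4 <=? a3]].

Definition search_all m r := all (search_from m r) (directions m r).

Lemma Zrange_mem lo k x : lo <= x < lo + Z.of_nat k -> x \in Zrange lo k.
Proof.
move=> xk; apply/mapP; exists (Z.to_nat (x - lo)); last by lia.
by rewrite mem_iota; lia.
Qed.

Lemma grid_mem A B C D a b c d :
  a \in A -> b \in B -> c \in C -> d \in D -> (a, b, c, d) \in grid A B C D.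
Proof. by move=> aA bB cC dD; do 3!apply: allpairs_f => //. Qed.

Definition flat (m : nat) (z : Z4) : Prop :=
  let: (z1, z2, z3, z4) := z in
  [/\ (m < 1)%nat -> z1 = 0, (m < 2)%nat -> z2 = 0,
      (m < 3)%nat -> z3 = 0 & (m < 4)%nat -> z4 = 0].

Definition centerable (m r : nat) (a : Z4) : Prop :=
  forall s : seq Z4, origin \in s -> a \in s ->
    (forall x : Z4, x \in s -> flat m x) ->
    (forall x y : Z4, x \in s -> y \in s -> dist4 x y <= Z.of_nat r) ->
    exists w, centered (Z.of_nat r) s w.

Lemma centered_isometry r (f g : Z4 -> Z4) (s : seq Z4) w :
  (forall x y, dist4 (f x) (f y) = dist4 x y) -> cancel f g -> cancel g f ->
  centered r [seq f x | x <- s] w -> centered r s (g w).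
Proof.
move=> fd fK gK [near hull]; split=> [x xs|z k zk].
  by rewrite -fd gK; apply: near; apply: map_f.
by rewrite -fd gK; apply: hull => _ /mapP[x xs ->]; rewrite fd; apply: zk.
Qed.

Lemma centerable_isometry m r (f : Z4 -> Z4) a :
  (forall x y, dist4 (f x) (f y) = dist4 x y) -> involutive f ->
  f origin = origin -> (forall z, flat m z -> flat m (f z)) ->
  centerable m r (f a) -> centerable m r a.
Proof.
move=> fd fK f0 ff Qfa s s0 sa sflat sdiam.
have [||x /mapP[y ys ->]|x y /mapP[x' xs ->] /mapP[y' ys ->]|w wP] :=
  Qfa [seq f x | x <- s].
- by rewrite -f0; apply: map_f.
- exact: map_f.
- by apply: ff; apply: sflat.
- by rewrite fd; apply: sdiam.
- by exists (f w); apply: centered_isometry wP.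
Qed.

Lemma search_centerable m r a1 a2 a3 a4 :
  search_all m r -> flat m (a1, a2, a3, a4) ->
  a1 + a2 + a3 + a4 = Z.of_nat r -> a2 <= a1 -> a3 <= a2 -> a4 <= a3 -> 0 <= a4 ->
  centerable m r (a1, a2, a3, a4).
Proof.
set a := (a1, a2, a3, a4).
move=> /allP/(_ a) srch aflat asum a12 a23 a34 a40 s s0 sa sflat sdiam.
have {}srch : search_from m r a.
  apply: srch; rewrite mem_filter; apply/andP; split.
    rewrite /a; apply/and4P.
    by split; [apply/Z.eqb_eq|apply/Z.leb_le|apply/Z.leb_le|apply/Z.leb_le]; lia.
  case: aflat => f1 f2 f3 f4.
  apply: grid_mem; case: ifPn => // km; try (apply: Zrange_mem; lia);
    by rewrite mem_seq1; apply/eqP; lia.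
apply: (search_sound _ srch) => //.
- move=> w x; rewrite mem_filter => /andP[/andP[/Z.ltb_lt w0 /Z.ltb_lt wa] _].
  by rewrite !inE => /orP[/eqP->|/eqP->]; lia.
- by move=> x; rewrite !inE => /orP[/eqP->|/eqP->].
- move=> x xs; apply/orP; right; rewrite mem_filter; apply/andP; split.
    by apply/andP; split; apply/Z.leb_le; apply: sdiam.
  have := sdiam _ _ s0 xs; have := sflat x xs.
  case: x {xs} => [[[x1 x2] x3] x4] [f1 f2 f3 f4]; rewrite /dist4 /origin => xr.
  apply: grid_mem; case: ifPn => // km; try (apply: Zrange_mem; lia);
    by rewrite mem_seq1; apply/eqP; lia.
Qed.

Definition swap12 (z : Z4) : Z4 := let: (a, b, c, d) := z in (b, a, c, d).
Definition swap23 (z : Z4) : Z4 := let: (a, b, c, d) := z in (a, c, b, d).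
Definition swap34 (z : Z4) : Z4 := let: (a, b, c, d) := z in (a, b, d, c).
Definition negate1 (z : Z4) : Z4 := let: (a, b, c, d) := z in (- a, b, c, d).
Definition negate2 (z : Z4) : Z4 := let: (a, b, c, d) := z in (a, - b, c, d).
Definition negate3 (z : Z4) : Z4 := let: (a, b, c, d) := z in (a, b, - c, d).
Definition negate4 (z : Z4) : Z4 := let: (a, b, c, d) := z in (a, b, c, - d).

Ltac isometry f := apply: (@centerable_isometry _ _ f);
  [ by move=> [[[? ?] ?] ?] [[[? ?] ?] ?]; rewrite /dist4 /=; lia
  | by move=> [[[? ?] ?] ?]; rewrite /= ?Z.opp_involutive
  | by [] | by move=> [[[? ?] ?] ?] /= [? ? ? ?]; split; lia | rewrite /= ].

(** Sign changes and swaps of coordinates make [a] nonnegative and decreasing. A swap is made only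
    when the coordinate moved forward is positive; flatness of [a] then forces [m] to exceed its
    index, so the swap preserves [flat m]. *)
Lemma centerable_all m r a :
  search_all m r -> flat m a -> dist4 origin a = Z.of_nat r -> centerable m r a.
Proof.
move=> srch.
pose T a1 a2 a3 a4 := flat m (a1, a2, a3, a4) ->
  Z.abs a1 + Z.abs a2 + Z.abs a3 + Z.abs a4 = Z.of_nat r ->
  centerable m r (a1, a2, a3, a4).
suff T0 a1 a2 a3 a4 : T a1 a2 a3 a4.
  case: a => [[[a1 a2] a3] a4] fa da; apply: T0 => //.
  by move: da; rewrite /dist4 /origin; lia.
have Tsorted b1 b2 b3 b4 : b2 <= b1 -> b3 <= b2 -> b4 <= b3 -> 0 <= b4 -> T b1 b2 b3 b4.
  by move=> ? ? ? ? ? ?; apply: search_centerable => //; lia.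
have Tsort123 b1 b2 b3 b4 : b2 <= b1 -> b3 <= b2 -> 0 <= b3 -> 0 <= b4 -> T b1 b2 b3 b4.
  move=> ? ? ? ?; have [?|?] := Z.leb_spec b4 b3; first exact: Tsorted.
  move=> [? ? ? ?] ?; isometry swap34.
  have [?|?] := Z.leb_spec b4 b2; first by apply: Tsorted; [..|split|]; lia.
  isometry swap23.
  have [?|?] := Z.leb_spec b4 b1; first by apply: Tsorted; [..|split|]; lia.
  by isometry swap12; apply: Tsorted; [..|split|]; lia.
have Tsort12 b1 b2 b3 b4 : b2 <= b1 -> 0 <= b2 -> 0 <= b3 -> 0 <= b4 -> T b1 b2 b3 b4.
  move=> ? ? ? ?; have [?|?] := Z.leb_spec b3 b2; first exact: Tsort123.
  move=> [? ? ? ?] ?; isometry swap23.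
  have [?|?] := Z.leb_spec b3 b1; first by apply: Tsort123; [..|split|]; lia.
  by isometry swap12; apply: Tsort123; [..|split|]; lia.
have Tpos b1 b2 b3 b4 : 0 <= b1 -> 0 <= b2 -> 0 <= b3 -> 0 <= b4 -> T b1 b2 b3 b4.
  move=> ? ? ? ?; have [?|?] := Z.leb_spec b2 b1; first exact: Tsort12.
  by move=> [? ? ? ?] ?; isometry swap12; apply: Tsort12; [..|split|]; lia.
have Tpos4 b1 b2 b3 b4 : 0 <= b1 -> 0 <= b2 -> 0 <= b3 -> T b1 b2 b3 b4.
  move=> ? ? ?; have [?|?] := Z.leb_spec 0 b4; first exact: Tpos.
  by move=> [? ? ? ?] ?; isometry negate4; apply: Tpos; [..|split|]; lia.
have Tpos34 b1 b2 b3 b4 : 0 <= b1 -> 0 <= b2 -> T b1 b2 b3 b4.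
  move=> ? ?; have [?|?] := Z.leb_spec 0 b3; first exact: Tpos4.
  by move=> [? ? ? ?] ?; isometry negate3; apply: Tpos4; [..|split|]; lia.
have Tpos234 b1 b2 b3 b4 : 0 <= b1 -> T b1 b2 b3 b4.
  move=> ?; have [?|?] := Z.leb_spec 0 b2; first exact: Tpos34.
  by move=> [? ? ? ?] ?; isometry negate2; apply: Tpos34; [..|split|]; lia.
have [?|?] := Z.leb_spec 0 a1; first exact: Tpos234.
by move=> [? ? ? ?] ?; isometry negate1; apply: Tpos234; [..|split|]; lia.
Qed.

Lemma search_centered m r (s : seq Z4) :
  search_all m r ->
  (forall x : Z4, x \in s -> flat m x) ->
  (forall x y : Z4, x \in s -> y \in s -> dist4 x y <= Z.of_nat r) ->
  (exists x y : Z4, [/\ x \in s, y \in s & dist4 x y = Z.of_nat r]) ->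
  exists w, centered (Z.of_nat r) s w.
Proof.
move=> srch sflat sdiam [x [y [xs ys xy]]].
pose sub (u v : Z4) : Z4 := let: (u1, u2, u3, u4) := u in
  let: (v1, v2, v3, v4) := v in (u1 - v1, u2 - v2, u3 - v3, u4 - v4).
pose add (u v : Z4) : Z4 := let: (u1, u2, u3, u4) := u in
  let: (v1, v2, v3, v4) := v in (u1 + v1, u2 + v2, u3 + v3, u4 + v4).
have subd u v : dist4 (sub u x) (sub v x) = dist4 u v.
  by case: x u v {xs xy} => [[[? ?] ?] ?] [[[? ?] ?] ?] [[[? ?] ?] ?] /=; lia.
have sub0 : sub x x = origin.
  by case: x {xs xy subd} => [[[? ?] ?] ?] /=; rewrite !Z.sub_diag.
have subK : cancel (sub^~ x) (add^~ x).
  case: x {xs xy subd sub0} => [[[? ?] ?] ?] [[[? ?] ?] ?] /=.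
  by rewrite !Z.sub_add.
have addK : cancel (add^~ x) (sub^~ x).
  case: x {xs xy subd sub0 subK} => [[[? ?] ?] ?] [[[? ?] ?] ?] /=.
  by rewrite !Z.add_simpl_r.
have subflat u : u \in s -> flat m (sub u x).
  move=> us; have := sflat u us; have := sflat x xs.
  case: x u {xs xy subd sub0 subK addK us} => [[[? ?] ?] ?] [[[? ?] ?] ?] /=.
  by move=> [? ? ? ?] [? ? ? ?]; split; lia.
have yflat := subflat y ys.
have yr : dist4 origin (sub y x) = Z.of_nat r by rewrite -sub0 subd.
have [||_ /mapP[u us ->]|_ _ /mapP[u us ->] /mapP[v vs ->]|w wP] :=
  centerable_all srch yflat yr (s := [seq sub u x | u <- s]).
- by rewrite -sub0; apply/mapP; exists x.
- by apply/mapP; exists y.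
- exact: subflat.
- by rewrite subd; apply: sdiam.
- by exists (add w x); exact: (centered_isometry subd subK addK wP).
Qed.
End SmallScale.

(** * Large radii: a real centre obtained by elimination, then rounded *)

Section LargeScale.
Local Unset Implicit Arguments.
Local Open Scope Z_scope.

(** This [h] is the support function of [s] on the diagonal functionals. *)
Lemma signed_sum_max (s : seq Z4) (x0 : Z4) : x0 \in s ->
  exists h : bool * bool -> bool * bool -> Z,
    (forall a b, exists2 x : Z4, x \in s & signed_sum a b x = h a b) /\
    (forall a b (x : Z4), x \in s -> signed_sum a b x <= h a b).
Proof.
case: s => // y s _ {x0}.
pose h a b := foldr (fun x => Z.max (signed_sum a b x)) (signed_sum a b y) s.
exists h; split=> a b; rewrite /h.
  elim: s {h} => [|x s [z zs zE]] /=; first by exists y; rewrite ?mem_head.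
  have [le|lt] := Z.leb_spec (signed_sum a b x) (signed_sum a b z).
    exists z; last by lia.
    by move: zs; rewrite !inE => /orP[->|->]; rewrite ?orbT.
  by exists x; [rewrite !inE eqxx orbT|lia].
move=> x; rewrite inE => /predU1P[->|].
  by elim: s {h} => [|z s] /=; lia.
elim: s {h} => [|z s IH] //=; rewrite inE => /predU1P[->|/IH]; lia.
Qed.

Variables (r : Z) (s : seq Z4) (h : bool * bool -> bool * bool -> Z).
Hypothesis h_attained : forall a b, exists2 x : Z4, x \in s & signed_sum a b x = h a b.
Hypothesis h_max : forall a b (x : Z4), x \in s -> signed_sum a b x <= h a b.
Hypothesis width : forall a b, h a b + h (opp_planar a) (opp_planar b) <= r.
Hypothesis r0 : 0 <= r.

(* Four times the bound required of the functional [(a, b)] at a real centre [c]: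
   [c] lies in the hull cut out by [h] and within [3r/4] of every point. *)
Let bound a b := Z.min (4 * h a b) (3 * r - 4 * h (opp_planar a) (opp_planar b)).

Lemma boundE a b :
  bound a b = Z.min (4 * h a b) (3 * r - 4 * h (opp_planar a) (opp_planar b)).
Proof. by []. Qed.

Lemma witness a b : exists2 x : Z4,
  x \in s & signed_sum a b x = - h (opp_planar a) (opp_planar b).
Proof.
have [x xs xE] := h_attained (opp_planar a) (opp_planar b).
by exists x => //; rewrite -xE signed_sum_opp Z.opp_involutive.
Qed.

Lemma width_ge0 a b : 0 <= h a b + h (opp_planar a) (opp_planar b).
Proof.
have [x xs xE] := h_attained a b; have := h_max (opp_planar a) (opp_planar b) x xs.
rewrite signed_sum_opp; lia.
Qed.

Lemma bound_opp a b : 0 <= bound a b + bound (opp_planar a) (opp_planar b).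
Proof.
have := width_ge0 a b; have := width a b; rewrite !boundE.
have -> : opp_planar (opp_planar a) = a by case: (a) => ? [].
have -> : opp_planar (opp_planar b) = b by case: (b) => ? [].
lia.
Qed.

Let total (f : bool * bool -> bool * bool -> Z)
    (M : seq (Z * ((bool * bool) * (bool * bool)))) : Z :=
  foldr (fun t acc => t.1 * f t.2.1 t.2.2 + acc) 0 M.

(* A vanishing nonnegative combination of functionals, evaluated at a point that
   minimises one of them, bounds the combination of the maxima from below by the
   weighted width of that one. *)
Lemma vanishing_total M : all (fun t => 0 <=? t.1) M ->
  (forall x, total (fun a b => signed_sum a b x) M = 0) ->
  forall k a b, (k, (a, b)) \in M ->
    k * (h a b + h (opp_planar a) (opp_planar b)) <= total h M.
Proof.
move=> M0 zero k a b kM; have [x xs xE] := witness a b.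
have le N : all (fun t => 0 <=? t.1) N ->
    total (fun a b => signed_sum a b x) N <= total h N /\
    ((k, (a, b)) \in N -> total (fun a b => signed_sum a b x) N
       + k * (h a b - signed_sum a b x) <= total h N).
  elim: N => [|[l [c d]] N IH] /=; first by split=> //; lia.
  move=> /andP[/Z.leb_le l0 /IH[le1 le2]].
  have lcd := Z.mul_le_mono_nonneg_l _ _ _ l0 (h_max c d x xs).
  split; first by lia.
  rewrite inE => /orP[/eqP[-> -> ->]|/le2]; lia.
have [_ /(_ kM)] := le M M0; rewrite zero xE; lia.
Qed.

(** Where the minimum in [bound] is its second term, it is [4 * h a b] plus [3 * r] minus four times
    a width. By [vanishing_total] the sum of the [h] terms absorbs one width with its coefficient;
    the other widths are at most [r]. The result is nonnegative because in every subfamily of the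
    terms the largest coefficient is at least a quarter of the total. This is where 3/4 comes from,
    here and for five and six terms. *)
Lemma bound_vanish4 a1 b1 a2 b2 a3 b3 a4 b4 :
  (forall x, signed_sum a1 b1 x + signed_sum a2 b2 x
             + signed_sum a3 b3 x + signed_sum a4 b4 x = 0) ->
  0 <= bound a1 b1 + bound a2 b2 + bound a3 b3 + bound a4 b4.
Proof.
move=> zero.
have V := vanishing_total [:: (1, (a1, b1)); (1, (a2, b2)); (1, (a3, b3)); (1, (a4, b4))] isT.
have {V}V := V (fun x => ltac:(have := zero x; rewrite /total; cbn -[Z.mul Z.add]; lia)).
have := V 1 a1 b1; have := V 1 a2 b2; have := V 1 a3 b3; have := V 1 a4 b4.
rewrite !inE !eqxx !orbT /total !boundE; cbn -[Z.mul Z.add].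
move=> /(_ isT) ? /(_ isT) ? /(_ isT) ? /(_ isT) ?.
have := width_ge0 a1 b1; have := width a1 b1; have := width a2 b2.
have := width a3 b3; have := width a4 b4.
lia.
Qed.

Lemma bound_vanish5 a1 b1 a2 b2 a3 b3 a4 b4 a5 b5 :
  (forall x, 2 * signed_sum a1 b1 x + signed_sum a2 b2 x
             + signed_sum a3 b3 x + signed_sum a4 b4 x + signed_sum a5 b5 x = 0) ->
  0 <= 2 * bound a1 b1 + bound a2 b2 + bound a3 b3 + bound a4 b4 + bound a5 b5.
Proof.
move=> zero.
have V := vanishing_total [:: (2, (a1, b1)); (1, (a2, b2)); (1, (a3, b3));
  (1, (a4, b4)); (1, (a5, b5))] isT.
have {V}V := V (fun x => ltac:(have := zero x; rewrite /total; cbn -[Z.mul Z.add]; lia)).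
have := V 2 a1 b1; have := V 1 a2 b2; have := V 1 a3 b3; have := V 1 a4 b4.
have := V 1 a5 b5.
rewrite !inE !eqxx !orbT /total !boundE; cbn -[Z.mul Z.add].
move=> /(_ isT) ? /(_ isT) ? /(_ isT) ? /(_ isT) ? /(_ isT) ?.
have := width_ge0 a1 b1; have := width a1 b1; have := width a2 b2.
have := width a3 b3; have := width a4 b4.
have := width a5 b5.
lia.
Qed.

Lemma bound_vanish6 a1 b1 a2 b2 a3 b3 a4 b4 a5 b5 a6 b6 :
  (forall x, signed_sum a1 b1 x + signed_sum a2 b2 x
             + signed_sum a3 b3 x + signed_sum a4 b4 x
             + 2 * signed_sum a5 b5 x + 2 * signed_sum a6 b6 x = 0) ->
  0 <= bound a1 b1 + bound a2 b2 + bound a3 b3 + bound a4 b4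
       + 2 * bound a5 b5 + 2 * bound a6 b6.
Proof.
move=> zero.
have V := vanishing_total [:: (1, (a1, b1)); (1, (a2, b2)); (1, (a3, b3));
  (1, (a4, b4)); (2, (a5, b5)); (2, (a6, b6))] isT.
have {V}V := V (fun x => ltac:(have := zero x; rewrite /total; cbn -[Z.mul Z.add]; lia)).
have := V 1 a1 b1; have := V 1 a2 b2; have := V 1 a3 b3; have := V 1 a4 b4.
have := V 2 a5 b5; have := V 2 a6 b6.
rewrite !inE !eqxx !orbT /total !boundE; cbn -[Z.mul Z.add].
move=> /(_ isT) ? /(_ isT) ? /(_ isT) ? /(_ isT) ? /(_ isT) ? /(_ isT) ?.
have := width_ge0 a1 b1; have := width a1 b1; have := width a2 b2.
have := width a3 b3; have := width a4 b4.
have := width a5 b5; have := width a6 b6.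
lia.
Qed.

(** In the coordinates [x = u + v], [y = u - v] the Manhattan plane becomes a maximum-norm plane.
    Each constraint then couples one of [u], [v] with one of [p], [q], up to signs, which keeps the
    elimination short. *)
Let axis (a : bool * bool) (u v : Z) : Z :=
  let t := if a.1 then u else v in if a.2 then t else - t.

Lemma planar_axis a u v : planar a (u + v) (u - v) = 2 * axis a u v.
Proof. by case: a => [[] []]; rewrite /planar /axis; cbn [fst snd]; lia. Qed.

(* Bounds on [+-p] and [+-p +- q] that remain when [u] and [v] are eliminated. *)
Let single b : Z :=
  Z.min (bound (true, true) b + bound (true, false) b)
        (bound (false, true) b + bound (false, false) b).

Let paired b b' : Z :=
  Z.min (Z.min (bound (true, true) b + bound (true, false) b')
               (bound (true, false) b + bound (true, true) b'))
        (Z.min (bound (false, true) b + bound (false, false) b')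
               (bound (false, false) b + bound (false, true) b')).

Lemma singleP b : exists a, single b = bound a b + bound (opp_planar a) b.
Proof.
have [E|E] : single b = bound (true, true) b + bound (true, false) b \/
  single b = bound (false, true) b + bound (false, false) b by rewrite /single; lia.
- by exists (true, true).
- by exists (false, true).
Qed.

Lemma pairedP b b' : exists a, paired b b' = bound a b + bound (opp_planar a) b'.
Proof.
have [E|[E|[E|E]]] : paired b b' = bound (true, true) b + bound (true, false) b' \/
  paired b b' = bound (true, false) b + bound (true, true) b' \/
  paired b b' = bound (false, true) b + bound (false, false) b' \/
  paired b b' = bound (false, false) b + bound (false, true) b'.
  by rewrite /paired; lia.
- by exists (true, true).
- by exists (true, false).
- by exists (false, true).
- by exists (false, false).
Qed.

Lemma opp_planarK : involutive opp_planar.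
Proof. by case=> ? []. Qed.

Lemma planar_opp a x y : planar (opp_planar a) x y = - planar a x y.
Proof. by case: a => [[] []]; rewrite /planar; cbn [fst snd negb opp_planar]; lia. Qed.

Ltac vanish :=
  move=> [[[x1 x2] x3] x4]; rewrite /signed_sum !planar_opp ?opp_planarK; lia.

Lemma single_single b : 0 <= single b + single (opp_planar b).
Proof.
have [a1 ->] := singleP b; have [a2 ->] := singleP (opp_planar b).
have : 0 <= bound a1 b + bound (opp_planar a1) b
  + bound a2 (opp_planar b) + bound (opp_planar a2) (opp_planar b).
  by apply: bound_vanish4; vanish.
lia.
Qed.

Lemma paired_paired b b' :
  0 <= paired b b' + paired (opp_planar b) (opp_planar b').
Proof.
have [a1 ->] := pairedP b b'; have [a2 ->] := pairedP (opp_planar b) (opp_planar b').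
have : 0 <= bound a1 b + bound (opp_planar a1) b'
  + bound a2 (opp_planar b) + bound (opp_planar a2) (opp_planar b').
  by apply: bound_vanish4; vanish.
lia.
Qed.

Lemma single_single_paired b b' :
  0 <= single b + single b' + 2 * paired (opp_planar b) (opp_planar b').
Proof.
have [a1 ->] := singleP b; have [a2 ->] := singleP b'.
have [a3 ->] := pairedP (opp_planar b) (opp_planar b').
have : 0 <= bound a1 b + bound (opp_planar a1) b + bound a2 b'
  + bound (opp_planar a2) b' + 2 * bound a3 (opp_planar b)
  + 2 * bound (opp_planar a3) (opp_planar b').
  by apply: bound_vanish6; vanish.
lia.
Qed.

Lemma same_axis a a' : a.1 = a'.1 -> a = a' \/ a = opp_planar a'.
Proof.
by case: a a' => [[] []] [[] []] //= _;
  [left|right|right|left|left|right|right|left].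
Qed.

Lemma bound_same_axis a a' b : a.1 = a'.1 ->
  bound a b + bound (opp_planar a) b = bound a' b + bound (opp_planar a') b.
Proof. by case/same_axis=> ->; rewrite ?opp_planarK; lia. Qed.

Lemma paired_paired_single b b' :
  0 <= paired b b' + paired b (opp_planar b') + single (opp_planar b).
Proof.
have [a1 ->] := pairedP b b'; have [a2 ->] := pairedP b (opp_planar b').
have [a3 ->] := singleP (opp_planar b).
(* There are only two axes. If [single] uses that of a [paired] term, an opposite pair of bounds
   drops out by [bound_opp]. Otherwise the two [paired] terms share an axis, and either five terms
   remain or an opposite pair splits off. *)
have [e13|/eqP n13] := eqVneq a3.1 a1.1.
  have := bound_opp a1 b; rewrite (bound_same_axis _ _ _ e13).
  have : 0 <= bound (opp_planar a1) b' + bound a2 b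
    + bound (opp_planar a2) (opp_planar b') + bound a1 (opp_planar b).
    by apply: bound_vanish4; vanish.
  lia.
have [e23|/eqP n23] := eqVneq a3.1 a2.1.
  have := bound_opp a2 b; rewrite (bound_same_axis _ _ _ e23).
  have : 0 <= bound a1 b + bound (opp_planar a1) b'
    + bound (opp_planar a2) (opp_planar b') + bound a2 (opp_planar b).
    by apply: bound_vanish4; vanish.
  lia.
have /same_axis[->|->] : a2.1 = a1.1 by case: (a1.1) (a2.1) (a3.1) n13 n23 => [] [] [].
  have : 0 <= 2 * bound a1 b + bound (opp_planar a1) b'
    + bound (opp_planar a1) (opp_planar b') + bound a3 (opp_planar b)
    + bound (opp_planar a3) (opp_planar b).
    by apply: bound_vanish5; vanish.
  lia.
have := bound_opp a1 (opp_planar b'); rewrite !opp_planarK.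
have : 0 <= bound a1 b + bound (opp_planar a1) b + bound a3 (opp_planar b)
  + bound (opp_planar a3) (opp_planar b).
  by apply: bound_vanish4; vanish.
lia.
Qed.

Lemma pairedC b b' : paired b b' = paired b' b.
Proof. rewrite /paired; lia. Qed.

Lemma octagon_point E11 E12 E21 E22 P1 P2 Q1 Q2 :
  0 <= P1 + P2 -> 0 <= Q1 + Q2 -> 0 <= E11 + E22 -> 0 <= E12 + E21 ->
  0 <= P1 + Q1 + 2 * E22 -> 0 <= P1 + Q2 + 2 * E21 ->
  0 <= P2 + Q1 + 2 * E12 -> 0 <= P2 + Q2 + 2 * E11 ->
  0 <= E11 + E12 + P2 -> 0 <= E21 + E22 + P1 ->
  0 <= E11 + E21 + Q2 -> 0 <= E12 + E22 + Q1 ->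
  exists p q, [/\ - P2 <= p <= P1, - Q2 <= q <= Q1,
    - (2 * E22) <= p + q <= 2 * E11 & - (2 * E21) <= p - q <= 2 * E12].
Proof.
move=> *.
(* [q] is the largest lower bound left after eliminating [p]. The last entry comes from combining
   the bounds on [p + q] and [p - q], whose factors 2 make its half integral. [p] is then its own
   largest lower bound. *)
pose q := Z.max (Z.max (- Q2) (- (2 * E12 + P2))) (Z.max (- (2 * E22 + P1)) (- (E22 + E12))).
exists (Z.max (- P2) (Z.max (- 2 * E21 + q) (- 2 * E22 - q))), q; rewrite /q.
split; lia.
Qed.

Lemma center_pq : exists p q,
  (forall b, axis b p q <= single b) /\
  (forall b b', b.1 != b'.1 -> axis b p q + axis b' p q <= 2 * paired b b').
Proof.
pose p1 := (true, true); pose p2 := (true, false).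
pose q1 := (false, true); pose q2 := (false, false).
have [||||||||||||p [q [pP qP sP dP]]] :=
  @octagon_point (paired p1 q1) (paired p1 q2) (paired p2 q1) (paired p2 q2)
    (single p1) (single p2) (single q1) (single q2).
- exact: (single_single p1).
- exact: (single_single q1).
- exact: (paired_paired p1 q1).
- exact: (paired_paired p1 q2).
- exact: (single_single_paired p1 q1).
- exact: (single_single_paired p1 q2).
- exact: (single_single_paired p2 q1).
- exact: (single_single_paired p2 q2).
- exact: (paired_paired_single p1 q1).
- exact: (paired_paired_single p2 q1).
- by rewrite (pairedC p1) (pairedC p2); exact: (paired_paired_single q1 p1).
- by rewrite (pairedC p1) (pairedC p2); exact: (paired_paired_single q2 p1).
exists p, q; split.
  case=> [[] []]; rewrite /axis; cbn [fst snd];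
    by move: pP qP; rewrite /p1 /p2 /q1 /q2; lia.
have pq (b b' : bool * bool) : b.1 -> ~~ b'.1 -> axis b p q + axis b' p q <= 2 * paired b b'.
  move: sP dP; rewrite /p1 /p2 /q1 /q2 /axis.
  by case: b b' => [[] []] [[] []] // + + _ _; cbn [fst snd]; lia.
move=> b b'; case b1: b.1; case b'1: b'.1 => // _; first by apply: pq; rewrite ?b1 ?b'1.
by rewrite pairedC Z.add_comm; apply: pq; rewrite ?b1 ?b'1.
Qed.

Lemma center_coordinate p q a :
  (forall b, axis b p q <= single b) ->
  (forall b b', b.1 != b'.1 -> axis b p q + axis b' p q <= 2 * paired b b') ->
  exists u, forall b, axis b p q + u <= 2 * bound (a, true) b /\
                      axis b p q - u <= 2 * bound (a, false) b.
Proof.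
move=> sP dP.
(* Every lower bound for [u] lies below every upper one: [paired] settles distinct axes, [single]
   equal functionals and [bound_opp] opposite ones. So the largest lower bound will do. *)
have gap b b' : axis b p q + axis b' p q <= 2 * bound (a, true) b + 2 * bound (a, false) b'.
  have [e|n] := eqVneq b.1 b'.1; last first.
    by have := dP b b' n; rewrite /paired; case: (a); lia.
  have [->|->] := same_axis _ _ e.
    by have := sP b'; rewrite /single; case: (a); lia.
  have := bound_opp (a, true) (opp_planar b'); rewrite opp_planarK.
  have -> : opp_planar (a, true) = (a, false) by [].
  by rewrite /axis /opp_planar; case: (b') => [[] []]; cbn [fst snd negb]; lia.
pose low b := axis b p q - 2 * bound (a, false) b.
pose u := Z.max (Z.max (low (true, true)) (low (true, false)))
                (Z.max (low (false, true)) (low (false, false))).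
exists u => b; have := gap b (true, true); have := gap b (true, false).
have := gap b (false, true); have := gap b (false, false).
have : low b <= u by rewrite /u; case: (b) => [[] []]; lia.
rewrite /u /low; lia.
Qed.

(* [X] is sixteen times the real centre. *)
Lemma real_center : exists X : Z4, forall a b,
  signed_sum a b X <= 16 * h a b /\
  signed_sum a b X <= 12 * r - 16 * h (opp_planar a) (opp_planar b).
Proof.
have [p [q [sP dP]]] := center_pq.
have [u uP] := center_coordinate p q true sP dP.
have [v vP] := center_coordinate p q false sP dP.
exists (u + v, u - v, p + q, p - q) => a b.
rewrite /signed_sum !planar_axis.
suff : axis a u v + axis b p q <= 2 * bound a b by rewrite boundE; lia.
have := uP b; have := vP b.
move: (axis b p q) => t; case: a => [[] []]; rewrite /axis; cbn [fst snd]; lia.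
Qed.

(* The nearest integer to [t / 16], ties being resolved upwards in [e t]. The only
   functional that such a rounding can increase by the full [2] is then the one with
   signs [e]. *)
Let nearest (e t : Z) : Z := e * ((e * t + 8) / 16).

Lemma nearestP e t : e = 1 \/ e = -1 -> - 8 < e * (16 * nearest e t - t) <= 8.
Proof.
rewrite /nearest => e1; have := Z.div_mod (e * t + 8) 16 ltac:(lia).
have := Z.mod_pos_bound (e * t + 8) 16 ltac:(lia).
by case: e1 => ->; lia.
Qed.

Let sgn (b : bool) : Z := if b then 1 else -1.

Lemma planar_near a a' x y :
  - 8 < sgn a'.2 * x <= 8 -> - 8 < sgn (if a'.1 then a'.2 else ~~ a'.2) * y <= 8 ->
  planar a x y <= 16 /\ (a <> a' -> planar a x y < 16).
Proof.
rewrite /planar /sgn => xP yP; split.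
  by case: a a' xP yP => [[] []] [[] []]; cbn [fst snd negb]; lia.
by case: a a' xP yP => [[] []] [[] []]; cbn [fst snd negb] => ? ? //; lia.
Qed.

(** In units of 1/16, rounding four coordinates raises a functional by at most 32, and by 32 only
    for [(a0, b0)], which has slack. So each functional at [w] stays strictly below [h a b + 2], and
    distances to [s] strictly below [3r/4 + 2], which is at most [r] once [r] is at least 8. *)
Lemma rounded_centered a0 b0 X : 8 <= r ->
  (forall a b, signed_sum a b X <= 16 * h a b /\
     signed_sum a b X <= 12 * r - 16 * h (opp_planar a) (opp_planar b)) ->
  signed_sum a0 b0 X < 16 * h a0 b0 ->
  signed_sum a0 b0 X < 12 * r - 16 * h (opp_planar a0) (opp_planar b0) ->
  exists w, centered r s w.
Proof.
case: X => [[[X1 X2] X3] X4] r8 XP X0 X0'.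
have sgnP b : sgn b = 1 \/ sgn b = -1 by case: b; [left|right].
have [e1 e2] := (sgnP a0.2, sgnP (if a0.1 then a0.2 else ~~ a0.2)).
have [e3 e4] := (sgnP b0.2, sgnP (if b0.1 then b0.2 else ~~ b0.2)).
have n1 := nearestP _ X1 e1; have n2 := nearestP _ X2 e2.
have n3 := nearestP _ X3 e3; have n4 := nearestP _ X4 e4.
move: n1 n2 n3 n4; set w1 := nearest _ X1; set w2 := nearest _ X2.
set w3 := nearest _ X3; set w4 := nearest _ X4 => n1 n2 n3 n4.
pose w : Z4 := (w1, w2, w3, w4).
have wX a b : 16 * signed_sum a b w = signed_sum a b (X1, X2, X3, X4)
    + planar a (16 * w1 - X1) (16 * w2 - X2) + planar b (16 * w3 - X3) (16 * w4 - X4).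
  rewrite /w /signed_sum; case: a b => [[] []] [[] []]; rewrite /planar; cbn [fst snd]; lia.
have wP a b : signed_sum a b w < h a b + 2 /\
    signed_sum a b w + h (opp_planar a) (opp_planar b) < r.
  have [Xh Xr] := XP a b; have := wX a b.
  have [le1 lt1] := planar_near a _ _ _ n1 n2; have [le2 lt2] := planar_near b _ _ _ n3 n4.
  have [Ea|/eqP/lt1] := eqVneq a a0; last by lia.
  have [Eb|/eqP/lt2] := eqVneq b b0; last by lia.
  by move: X0 X0'; rewrite -Ea -Eb; lia.
exists w; apply: hull_centered => [x xs|a b].
  have [a [b ->]] := dist4_signed_sum w x.
  have := h_max (opp_planar a) (opp_planar b) x xs; rewrite signed_sum_opp.
  by have [_] := wP a b; lia.
have [x xs xE] := h_attained a b; exists x => //.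
by have [] := wP a b; lia.
Qed.

Lemma large_centered_aux : 8 <= r ->
  (exists x y : Z4, [/\ x \in s, y \in s & dist4 x y = r]) ->
  exists w, centered r s w.
Proof.
move=> r8 [x [y [xs ys xy]]]; have [X XP] := real_center.
have [a [b ab]] := dist4_signed_sum x y.
have hr : h a b + h (opp_planar a) (opp_planar b) = r.
  have := width a b; have := h_max a b x xs.
  by have := h_max (opp_planar a) (opp_planar b) y ys; rewrite signed_sum_opp; lia.
have [X1 X2] := XP a b; have [X1' X2'] := XP (opp_planar a) (opp_planar b).
(* For a functional of width [r] the second bound on [X] is below the first by [4r], and it cannot
   be attained by both the functional and its opposite. One of the two thus has the slack needed for
   ties. *)
have [lt|ge] := Z.ltb_spec (signed_sum a b X)
  (12 * r - 16 * h (opp_planar a) (opp_planar b)).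
  by apply: (rounded_centered a b X) => //; lia.
by apply: (rounded_centered (opp_planar a) (opp_planar b) X) => //;
  move: X1' X2'; rewrite signed_sum_opp !opp_planarK; lia.
Qed.
End LargeScale.

Lemma large_centered (r : Z) (s : seq Z4) : Z.le 8 r ->
  (forall x y : Z4, x \in s -> y \in s -> Z.le (dist4 x y) r) ->
  (exists x y : Z4, [/\ x \in s, y \in s & dist4 x y = r]) ->
  exists w, centered r s w.
Proof.
move=> r8 diam xyP; have [x [_ [xs _ _]]] := xyP.
have [h [hE hmax]] := signed_sum_max s x xs.
apply: (large_centered_aux r s h hE hmax _ _ r8 xyP); last by lia.
move=> a b; have [y ys <-] := hE a b.
have [z zs <-] := hE (opp_planar a) (opp_planar b).
rewrite signed_sum_opp; have := diam _ _ ys zs.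
have := @signed_sum_le_dist4 a b y z; lia.
Qed.

(** For each [r] from 2 to 7 only the largest dimension, the minimum of [r - 1] and 4, is searched;
    [flat_weaken] embeds the smaller ones. *)
Lemma small_scales :
  all (fun mr => search_all mr.1 mr.2)
    [:: (1, 2); (2, 3); (3, 4); (4, 5); (4, 6); (4, 7)].
Proof. by vm_compute. Qed.

Lemma flat_weaken m m' x : (m <= m')%N -> flat m x -> flat m' x.
Proof.
move: x => [[[x1 x2] x3] x4] le [f1 f2 f3 f4].
by split=> lt; [apply: f1|apply: f2|apply: f3|apply: f4]; lia.
Qed.

Lemma centered_exists m r (s : seq Z4) : s != [::] -> (0 < m <= 4)%N -> (m < r)%N ->
  (forall x : Z4, x \in s -> flat m x) ->
  (forall x y : Z4, x \in s -> y \in s -> Z.le (dist4 x y) (Z.of_nat r)) ->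
  exists w, centered (Z.of_nat r) s w.
Proof.
move=> s0 m4 mr sflat diam.
have [/hasP[x xs /hasP[y ys /Z.eqb_eq xy]]|/hasPn no] :=
  boolP (has (fun x => has (fun y => Z.eqb (dist4 x y) (Z.of_nat r)) s) s).
  have xyP : exists x y : Z4, [/\ x \in s, y \in s & dist4 x y = Z.of_nat r].
    by exists x, y.
  have [r8|r8] := leqP 8 r; first by apply: large_centered => //; lia.
  have srch k : (m <= k)%N -> (k, r) \in [:: (1, 2); (2, 3); (3, 4); (4, 5); (4, 6); (4, 7)] ->
      exists w, centered (Z.of_nat r) s w.
    move=> mk /(allP small_scales) sr; apply: (search_centered sr) => // z zs.
    exact: flat_weaken mk (sflat z zs).
  have : r \in [:: 2; 3; 4; 5; 6; 7] by rewrite !inE; lia.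
  rewrite !inE => /or4P[/eqP r2|/eqP r3|/eqP r4|/or3P[/eqP r5|/eqP r6|/eqP r7]].
  - by apply: (srch 1); [lia|rewrite r2].
  - by apply: (srch 2); [lia|rewrite r3].
  - by apply: (srch 3); [lia|rewrite r4].
  - by apply: (srch 4); [lia|rewrite r5].
  - by apply: (srch 4); [lia|rewrite r6].
  - by apply: (srch 4); [lia|rewrite r7].
case: s s0 {sflat} diam no => // x s _ diam no.
exists x; split=> [y ys|z k zk]; last by have := zk x (mem_head _ _); lia.
have := diam x y (mem_head _ _) ys.
have /hasPn/(_ y ys) := no x (mem_head _ _).
move=> /negP nxy le; have ne : dist4 x y <> Z.of_nat r by move/Z.eqb_eq.
by lia.
Qed.

(** * Coordinate hyperplanes projected to [Z4], padded with zeros *)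

Section Hyperplane.
Variables (k : nat) (i : 'I_k.+1).

Let coord (x : Zn k.+1) (j : nat) : Z :=
  if insub j is Some j' then Z_of_int (x (lift i j')) else Z0.

Let proj (x : Zn k.+1) : Z4 := (coord x 0, coord x 1, coord x 2, coord x 3).

Let nth4 (w : Z4) (j : nat) : Z :=
  let: (w0, w1, w2, w3) := w in nth Z0 [:: w0; w1; w2; w3] j.

Let lift4 (c : int) (w : Z4) : Zn k.+1 :=
  [ffun l => if unlift i l is Some j then int_of_Z (nth4 w j) else c].

Lemma coord_lt x j (jk : (j < k)%N) :
  coord x j = Z_of_int (x (lift i (Ordinal jk))).
Proof. by rewrite /coord insubT. Qed.

Lemma coord_ge x j : (k <= j)%N -> coord x j = Z0.
Proof. by move=> kj; rewrite /coord insubF // ltnNge kj. Qed.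

Lemma l1dist_lift (x y : Zn k.+1) :
  l1dist x y = (`|x i - y i| + \sum_(j < k) `|x (lift i j) - y (lift i j)|)%N.
Proof. by rewrite /l1dist (bigD1_ord i). Qed.

Lemma dist4_nth (x y : Z4) : dist4 x y =
  Z.of_nat (\sum_(j < 4) Z.abs_nat (nth4 x j - nth4 y j)).
Proof.
case: x y => [[[x0 x1] x2] x3] [[[y0 y1] y2] y3].
by rewrite !big_ord_recr big_ord0 /=; lia.
Qed.

Lemma nth4_proj x j : (j < 4)%N -> nth4 (proj x) j = coord x j.
Proof. by case: j => [|[|[|[|j]]]]. Qed.

Lemma l1dist_proj (x y : Zn k.+1) : (k <= 4)%N ->
  Z.of_nat (l1dist x y) = Z.add (Z.of_nat `|x i - y i|) (dist4 (proj x) (proj y)).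
Proof.
move=> k4; rewrite l1dist_lift dist4_nth Nat2Z.inj_add; congr (Z.add _ (Z.of_nat _)).
have E (j : 'I_k) : `|x (lift i j) - y (lift i j)|%N
    = Z.abs_nat (coord x j - coord y j).
  have jk := ltn_ord j; rewrite !(coord_lt _ jk).
  by rewrite (_ : Ordinal jk = j); [lia|apply: val_inj].
rewrite (eq_bigr _ (fun j _ => E j)).
rewrite (big_ord_widen 4 (fun j => Z.abs_nat (coord x j - coord y j))) // big_mkcond.
apply: eq_bigr => j _; rewrite !nth4_proj //; case: ifPn => // kj.
move: kj; rewrite -leqNgt => kj.
by rewrite (coord_ge x kj) (coord_ge y kj).
Qed.

(** A centre found in [Z4] may have nonzero padding coordinates; dropping them only brings it nearer
    to points without them. *)
Lemma dist4_lift c (w z : Z4) :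
  (forall j, (k <= j)%N -> nth4 z j = Z0) -> (k <= 4)%N ->
  Z.le (dist4 (proj (lift4 c w)) z) (dist4 w z).
Proof.
move=> z0 k4; rewrite !dist4_nth.
suff : (\sum_(j < 4) Z.abs_nat (nth4 (proj (lift4 c w)) j - nth4 z j)
        <= \sum_(j < 4) Z.abs_nat (nth4 w j - nth4 z j))%N by lia.
apply: leq_sum => j _.
rewrite nth4_proj //; have [jk|kj] := ltnP j k; last first.
  by rewrite (coord_ge _ kj) (z0 _ kj).
by rewrite (coord_lt _ jk) ffunE liftK int_of_ZK.
Qed.

Lemma hyperplane_center (r : nat) (s : seq (Zn k.+1)) (c : int) :
  s != [::] -> (0 < k <= 4)%N -> (k < r)%N ->
  (forall x : Zn k.+1, x \in s -> x i = c) ->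
  (forall x y : Zn k.+1, x \in s -> y \in s -> (l1dist x y <= r)%N) ->
  exists w : Zn k.+1,
    (forall x : Zn k.+1, x \in s -> (l1dist w x < r)%N) /\
    (forall (z : Zn k.+1) m, (forall x : Zn k.+1, x \in s -> (l1dist z x <= m)%N) ->
      (l1dist z w <= m.+1)%N).
Proof.
move=> s0 k14 kr sc diam; have k4 : (k <= 4)%N by lia.
have nth_ge x j : (k <= j)%N -> nth4 (proj x) j = Z0.
  move=> kj; have [j4|] := ltnP j 4; first by rewrite nth4_proj // (coord_ge _ kj).
  by case: j {kj} => [|[|[|[|j]]]] //= _; rewrite nth_nil.
have [|_ /mapP[x xs ->]|_ _ /mapP[x xs ->] /mapP[y ys ->]|w [near hull]] :=
  @centered_exists k r [seq proj x | x <- s] _ k14 kr.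
- by case: (s) s0.
- by split=> kj; exact: coord_ge kj.
- have := l1dist_proj x y k4; rewrite (sc x xs) (sc y ys) subrr.
  by have := diam x y xs ys; lia.
exists (lift4 c w); split=> [x xs|z m zm].
  have := l1dist_proj (lift4 c w) x k4; rewrite (sc x xs) ffunE unlift_none subrr.
  have := @dist4_lift c w (proj x) (nth_ge x) k4.
  have := near _ (map_f proj xs).
  lia.
have zw := l1dist_proj z (lift4 c w) k4.
have le := @dist4_lift c w (proj z) (nth_ge z) k4.
(* Reaching the hyperplane uses up [|z i - c|] of the bound [m]; the rest bounds the projected
   distances. *)
have := hull (proj z) (Z.sub (Z.of_nat m) (Z.of_nat `|z i - c|)).
move: zw le; rewrite ffunE unlift_none (dist4C _ (proj z)) (dist4C w).
move=> zw le /(_ _)/wrap [_ /mapP[x xs ->]|]; last by lia.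
by have := zm x xs; have := l1dist_proj z x k4; rewrite (sc x xs); lia.
Qed.
End Hyperplane.

(** * Apexes of the removed simplices *)

Local Open Scope ring_scope.

Lemma seq_argmin (T : eqType) (f : T -> int) (s : seq T) : s != [::] ->
  exists2 x, x \in s & forall y, y \in s -> f x <= f y.
Proof.
elim: s => // x [|x' s] IH _.
  by exists x; rewrite ?mem_head // => y; rewrite inE => /eqP->.
have [//|y ys ymin] := IH.
have [le|lt] := leP (f x) (f y).
  exists x; first exact: mem_head.
  by move=> z; rewrite inE => /predU1P[->//|/ymin]; apply: le_trans.
exists y; first by rewrite inE ys orbT.
by move=> z; rewrite inE => /predU1P[->|/ymin//]; apply: ltW.
Qed.

Lemma seq_argmax (T : eqType) (f : T -> int) (s : seq T) : s != [::] ->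
  exists2 x, x \in s & forall y, y \in s -> f y <= f x.
Proof.
move=> /(@seq_argmin _ (fun x => - f x)) [x xs xmin]; exists x => // y /xmin.
by rewrite lerN2.
Qed.

(** * Projection to a box *)

Section Clamp.
Variables (n : nat) (lo hi : 'I_n -> int).

Definition clamp (x : Zn n) : Zn n := [ffun l => Num.max (lo l) (Num.min (x l) (hi l))].

Definition in_box (x : Zn n) : Prop := forall l, lo l <= x l <= hi l.

(** The clamped point is a gate: it lies on a geodesic from [z] to every point of the box. *)
Lemma l1dist_clamp (z x : Zn n) : in_box x ->
  l1dist z x = (l1dist z (clamp z) + l1dist (clamp z) x)%N.
Proof.
move=> xb; rewrite /l1dist -big_split /=; apply: eq_bigr => l _.
by rewrite !ffunE; have := xb l; lia.
Qed.

Lemma l1dist_clamp_le (z x : Zn n) : in_box x ->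
  (l1dist (clamp z) x <= l1dist z x)%N.
Proof. by move=> xb; rewrite (l1dist_clamp z xb) leq_addl. Qed.
End Clamp.

Lemma l1distC n (x y : Zn n) : l1dist x y = l1dist y x.
Proof. by apply: eq_bigr => l _; lia. Qed.

(** The centre is clamped to the bounding box of [s], so that its stage can be controlled later. For
    the last property [z] is clamped too, and the length of that move is deducted from [m]. *)
Lemma boxed_hyperplane_center n r (i : 'I_n) (s : seq (Zn n)) (c : int) :
  s != [::] -> (2 <= n <= 5)%N -> (n <= r)%N ->
  (forall x : Zn n, x \in s -> x i = c) ->
  (forall x y : Zn n, x \in s -> y \in s -> (l1dist x y <= r)%N) ->
  exists w : Zn n,
    [/\ forall l, exists x y : Zn n, [/\ x \in s, y \in s & x l <= w l <= y l],
        forall x : Zn n, x \in s -> (l1dist w x < r)%N &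
        forall (z : Zn n) m, (forall x : Zn n, x \in s -> (l1dist z x <= m)%N) ->
          (l1dist z w <= m.+1)%N].
Proof.
case: n i s => [|k] i s // s0 nP nr sc diam.
have [||w [near hull]] := hyperplane_center s0 _ _ sc diam; try lia.
have /fin_all_exists[lo loP] (l : 'I_k.+1) : exists v : int,
    (exists2 x, x \in s & x l = v) /\ forall x : Zn k.+1, x \in s -> v <= x l.
  have [x xs xmin] := seq_argmin (fun x : Zn k.+1 => x l) s0.
  by exists (x l); split=> //; exists x.
have /fin_all_exists[hi hiP] (l : 'I_k.+1) : exists v : int,
    (exists2 x, x \in s & x l = v) /\ forall x : Zn k.+1, x \in s -> x l <= v.
  have [x xs xmax] := seq_argmax (fun x : Zn k.+1 => x l) s0.
  by exists (x l); split=> //; exists x.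
have box x : x \in s -> in_box lo hi x.
  by move=> xs l; rewrite (loP l).2 // (hiP l).2.
have lohi l : lo l <= hi l.
  by have [[x xs <-] _] := loP l; apply: (hiP l).2.
have boxc z : in_box lo hi (clamp lo hi z).
  by move=> l; rewrite ffunE; have := lohi l; lia.
exists (clamp lo hi w); split=> [l|x xs|z m zm].
- have [[x xs xl] _] := loP l; have [[y ys yl] _] := hiP l.
  by exists x, y; split=> //; rewrite xl yl; apply: boxc.
- exact: leq_ltn_trans (l1dist_clamp_le _ (box x xs)) (near x xs).
- rewrite (l1dist_clamp z (boxc w)).
  set e := l1dist z _.
  have em : (e <= m)%N.
    case: s s0 zm {sc diam near hull loP hiP} box => // x s _ zm box.
    apply: leq_trans (zm x (mem_head _ _)).
    by rewrite (l1dist_clamp z (box x (mem_head _ _))) leq_addr.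
  have := hull (clamp lo hi z) (m - e)%N.
  have := l1dist_clamp_le w (boxc z); rewrite l1distC (l1distC w) => le1.
  move=> H; suff : (l1dist (clamp lo hi z) w <= (m - e).+1)%N by lia.
  apply: H => x xs; have := zm x xs.
  by rewrite (l1dist_clamp z (box x xs)) -/e; lia.
Qed.

(* [0, 1, -1, 2, -2, ...] are numbered [0, 1, 2, 3, 4, ...]. *)
Definition zigzag (x : int) : nat := (`|x|.*2 - (0 < x)%R)%N.

(** A stage [j] encodes the coordinate [j mod n] and the value numbered [j / n] in it, so all points
    of one stage at least [n] lie in one face of a box. Only the origin has stage below [n]. *)
Definition stage (n : nat) (v : Zn n) : nat := (\max_(l < n) (n * zigzag (v l) + l))%N.

Lemma stage_ge n (v : Zn n) l : (n * zigzag (v l) + l <= stage v)%N.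
Proof. exact: (leq_bigmax l). Qed.

Lemma stage_ltP n (v : Zn n) j : (0 < j)%N ->
  (forall l, n * zigzag (v l) + l < j)%N -> (stage v < j)%N.
Proof. by case: j => // j _ H; rewrite ltnS; apply/bigmax_leqP => l _; apply: H. Qed.

Lemma stage_attained n (v : Zn n) : (0 < n)%N ->
  exists l, stage v = (n * zigzag (v l) + l)%N.
Proof.
move=> n0; rewrite /stage.
have [|l ->] := @bigop.eq_bigmax 'I_n (fun l => n * zigzag (v l) + l)%N.
  by rewrite card_ord.
by exists l.
Qed.

Lemma zigzag_inj : injective zigzag.
Proof. by move=> x y; rewrite /zigzag; lia. Qed.

Lemma apex_exists n r j (s : seq (Zn n)) :
  (2 <= n <= 5)%N -> (n <= r)%N -> (n <= j)%N -> s != [::] ->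
  (forall x : Zn n, x \in s -> stage x = j) ->
  (forall x y : Zn n, x \in s -> y \in s -> (l1dist x y <= r)%N) ->
  exists w : Zn n,
    [/\ (stage w < j)%N, forall x : Zn n, x \in s -> (l1dist w x <= r)%N &
        forall z : Zn n, (stage z < j)%N ->
          (forall x : Zn n, x \in s -> (l1dist z x <= r)%N) -> (l1dist z w <= r)%N].
Proof.
move=> nP nr nj s0 sj diam; have n0 : (0 < n)%N by lia.
have uniq_l a (l : 'I_n) : (n * a + l = j)%N -> l = (j %% n)%N :> nat /\ a = (j %/ n)%N.
  by move=> <-; rewrite mulnC modnMDl modn_small // divnMDl // divn_small ?addn0.
pose i : 'I_n := Ordinal (ltn_pmod j n0).
have top x : x \in s -> zigzag (x i) = (j %/ n)%N.
  move=> xs; have [l] := stage_attained x n0; rewrite (sj x xs) => /esym/uniq_l[li <-].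
  by congr (zigzag (x _)); apply: val_inj.
have N0 : (0 < j %/ n)%N by rewrite divn_gt0.
have jE : (j = n * (j %/ n) + i)%N by rewrite mulnC [LHS](divn_eq j n).
have [c sc] : exists c, forall x, x \in s -> x i = c.
  case: s s0 top {sj diam} => // x s _ top; exists (x i) => y ys.
  by apply: zigzag_inj; rewrite !top ?mem_head.
have cN : zigzag c = (j %/ n)%N.
  by case: s s0 top sc {sj diam} => // x s _ top sc; rewrite -(sc x) ?top ?mem_head.
have [w0 [w0box w0near w0hull]] := boxed_hyperplane_center s0 nP nr sc diam.
have w0i : w0 i = c.
  by have [x [y [xs ys]]] := w0box i; rewrite (sc x xs) (sc y ys); lia.
(* [c'] is one step from [c] towards 0; [c] is nonzero since its number is positive. *)
pose c' : int := if 0 < c then c - 1 else c + 1.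
have c'N : (zigzag c' < zigzag c)%N by move: N0; rewrite -cN /c' /zigzag; case: ifP; lia.
pose w : Zn n := [ffun l => if l == i then c' else w0 l].
have split_i (x y : Zn n) :
    l1dist x y = (`|x i - y i| + \sum_(l < n | l != i) `|x l - y l|)%N.
  by rewrite /l1dist (bigD1 i).
have wE (x : Zn n) : (l1dist x w + `|(x i - c)%R| = l1dist x w0 + `|(x i - c')%R|)%N.
  have E : (\sum_(l < n | l != i) `|x l - w l| = \sum_(l < n | l != i) `|x l - w0 l|)%N.
    by apply: eq_bigr => l /negPf li; rewrite ffunE li.
  rewrite !split_i E w0i ffunE eqxx; set S := (\sum_(_ < _ | _) _)%N; lia.
exists w; split=> [|x xs|z zj zs].
- apply: stage_ltP => [|l]; first by lia.
  rewrite ffunE; case: eqP => [->|li].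
    by rewrite jE -cN; move: c'N; nia.
  (* Away from [i] the value [n * a + l] is never [j], which makes the bound by the stages of [s]
     strict. *)
  have lj a : (n * a + l)%N <> j.
    by move=> /uniq_l[lj _]; apply: li; apply: val_inj.
  have [x [y [xs ys xwy]]] := w0box l.
  have := stage_ge x l; have := stage_ge y l; rewrite (sj x xs) (sj y ys).
  have : (zigzag (w0 l) <= maxn (zigzag (x l)) (zigzag (y l)))%N.
    by move: xwy; rewrite /zigzag; lia.
  have := lj (zigzag (w0 l)); nia.
- have := wE x; rewrite (sc x xs) l1distC (l1distC x w0).
  by have := w0near x xs; rewrite /c'; case: ifP; lia.
- have := w0hull z r zs; have := wE z.
  (* A point of smaller stage has its [i]-th coordinate on the side of [c] where [c'] lies, so
     moving the centre to [c'] shortens the distance by exactly 1. *)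
  have : (zigzag (z i) < zigzag c)%N.
    by have := stage_ge z i; rewrite cN; move: zj; rewrite {1}jE; nia.
  by rewrite /c' /zigzag; case: ifP; lia.
Qed.

(** * Contraction by successive collapses *)

Local Open Scope fset_scope.
Local Open Scope ring_scope.

Section Collapse.
Variables (R : realFieldType) (V : choiceType).
Implicit Types (p q : V -> R) (t u d e : R) (A B S : {fset V}).

Definition point (Y : {fset V} -> Prop) p : Prop :=
  exists A, [/\ Y A, forall v, v \notin A -> p v = 0, forall v, 0 <= p v &
                \sum_(v <- A) p v = 1].

Definition near_fun d p q : Prop := forall v, `|p v - q v| < d.

Definition continuous_at (F : (V -> R) -> R -> V -> R) p t : Prop :=
  forall e, 0 < e -> exists2 d, 0 < d &
    forall q u, near_fun d p q -> `|t - u| < d -> near_fun e (F p t) (F q u).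

(* The default value [1] never matters: points take values in [[0, 1]]. *)
Definition min_on S p : R := \big[Num.min/1]_(v <- S) p v.

Lemma min_on_near S p q d : 0 < d -> near_fun d p q -> `|min_on S p - min_on S q| < d.
Proof.
move=> d0 pq; rewrite /min_on; elim: (enum_fset S) => [|v s IH].
  by rewrite !big_nil subrr normr0.
rewrite !big_cons; have := pq v; move: IH; set a := \big[_/_]_(_ <- _) _.
set b := \big[_/_]_(_ <- _) _.
rewrite !ltr_norml => /andP[? ?] /andP[? ?].
by case: (leP (p v) a) => ?; case: (leP (q v) b) => ?; apply/andP; split; lra.
Qed.

Lemma min_on_ge0 S p : (forall v, 0 <= p v) -> 0 <= min_on S p.
Proof.
move=> p0; rewrite /min_on; apply: (big_ind (fun x => 0 <= x)) => // x y x0 y0.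
by rewrite le_min x0.
Qed.

Lemma min_on_le S p v : v \in S -> min_on S p <= p v.
Proof.
rewrite /min_on -[v \in S]/(v \in enum_fset S); elim: (enum_fset S) => // w s IH.
rewrite inE big_cons => /predU1P[->|/IH le]; first by rewrite ge_min lexx.
by rewrite ge_min le orbT.
Qed.

Lemma min_on_attained S p : S != fset0 -> (forall v, p v <= 1) ->
  exists2 v, v \in S & min_on S p = p v.
Proof.
move=> S0 p1; have [v0 v0S] := fset0Pn _ S0.
suff [//|E] : (exists2 v, v \in S & min_on S p = p v) \/ min_on S p = 1.
  by exists v0 => //; apply: le_anti; rewrite min_on_le // E p1.
rewrite /min_on; have : {subset enum_fset S <= S} by [].
elim: (enum_fset S) => [|w s IH] sub; first by right; rewrite big_nil.
rewrite big_cons; have [|[v vS ->]|->] := IH.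
- by move=> v vs; apply: sub; rewrite inE vs orbT.
- have wS : w \in S by apply: sub; rewrite mem_head.
  by left; case: leP => _; [exists w|exists v].
- by left; exists w; [apply: sub; rewrite mem_head|apply/min_idPl].
Qed.

Variables (X : {fset V} -> Prop) (act : nat -> seq {fset V}) (apex : {fset V} -> V).

(* [act k] lists the simplices removed in passing from [remaining k.+1] to
   [remaining k]; the removals run through decreasing [k]. *)
Definition remaining (k : nat) A : Prop :=
  X A /\ forall k' S, (k <= k')%N -> S \in act k' -> ~~ (S `<=` A).

Definition spread S v : R := #|` S|%:R * (v == apex S)%:R - (v \in S)%:R.

(** Each vertex of [S] sends the fraction [t] of the least mass on [S] to the apex, so the total is
    preserved. For nonnegative [p], a simplex not contained in the support has minimum 0 and
    contributes nothing. *)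
Definition push (k : nat) p t v : R :=
  p v + t * \sum_(S <- act k) min_on S p * spread S v.

Lemma push_continuous k p t : continuous_at (push k) p t.
Proof.
pose F (l : seq {fset V}) (p : V -> R) (t : R) (v : V) : R :=
  p v + t * \sum_(S <- l) min_on S p * spread S v.
suff cF l : continuous_at (F l) p t by exact: (cF (act k)).
elim: l => [|S l IH] e e0.
  by exists e => // q u pq tu v; rewrite /F !big_nil !mulr0 !addr0.
have [d1 d10 d1P] := IH (e / 2) ltac:(lra).
pose C : R := #|` S|%:R + 1.
have C0 : 0 < C by rewrite ltr_wpDl // ler0n.
have spreadC v : `|spread S v| <= C.
  rewrite /spread /C; apply: le_trans (ler_normB _ _) _.
  have b1 (b : bool) : `|b%:R| <= 1 :> R by case: b; rewrite ?normr1 ?normr0.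
  by apply: lerD; rewrite ?b1 // normrM normr_nat ler_piMr.
set m := min_on S p.
(* With [m'] the minimum for [q], [t m - u m' = t (m - m') + (t - u) m'] and [|m'| <= |m| + 1];
   hence the factor next to [C]. *)
pose M : R := C * (`|t| + `|m| + 1).
have M0 : 0 < M by rewrite mulr_gt0 // ltr_wpDl // addr_ge0.
exists (Num.min 1 (Num.min d1 (e / 2 / M))).
  by rewrite !lt_min d10 ltr01 /= divr_gt0 //; lra.
move=> q u pq; rewrite !lt_min => /and3P[tu1 tud tue] v.
have pqd d : Num.min 1 (Num.min d1 (e / 2 / M)) <= d -> near_fun d p q.
  by move=> le w; apply: lt_le_trans (pq w) le.
have near1 : `|m - min_on S q| < 1.
  by apply: min_on_near => //; apply: pqd; rewrite ge_min lexx.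
have neare : `|m - min_on S q| < e / 2 / M.
  apply: min_on_near; first by rewrite divr_gt0 //; lra.
  by apply: pqd; rewrite !ge_min lexx !orbT.
have neard : near_fun d1 p q by apply: pqd; rewrite !ge_min lexx !orbT.
have := d1P q u neard tud v.
have term : `|t * m * spread S v - u * min_on S q * spread S v| < e / 2.
  rewrite -mulrBl normrM.
  have -> : t * m - u * min_on S q = t * (m - min_on S q) + (t - u) * min_on S q by ring.
  have mq : `|min_on S q| <= `|m| + 1.
    have -> : min_on S q = m - (m - min_on S q) by ring.
    by apply: le_trans (ler_normB _ _) _; rewrite lerD2l ltW.
  have lt : `|t * (m - min_on S q) + (t - u) * min_on S q| < e / 2 / C.
    apply: le_lt_trans (ler_normD _ _) _; rewrite !normrM.
    set x := `|m - _| in neare *; set y := `|t - u| in tue *.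
    have z0 : 0 < e / 2 / M by rewrite divr_gt0 //; lra.
    have -> : e / 2 / C = (e / 2 / M) * (`|t| + `|m| + 1).
      by rewrite /M; field; rewrite !gt_eqF //; rewrite ltr_wpDl // addr_ge0.
    have h1 : `|t| * x <= `|t| * (e / 2 / M) by rewrite ler_wpM2l // ltW.
    have h2 : y * `|min_on S q| <= y * (`|m| + 1) by rewrite ler_wpM2l //; exact: normr_ge0.
    have h3 : y * (`|m| + 1) < (e / 2 / M) * (`|m| + 1).
      by rewrite ltr_pM2r // ltr_wpDl.
    lra.
  apply: (@le_lt_trans _ _ (`|t * (m - min_on S q) + (t - u) * min_on S q| * C)).
    by rewrite ler_wpM2l.
  by rewrite -ltr_pdivlMr.
rewrite /F !big_cons -/m.
have -> a b c g h i : a + t * (b + c) - (g + u * (h + i))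
   = (a + t * c - (g + u * i)) + (t * b - u * h) :> R by ring.
move=> lt; apply: le_lt_trans (ler_normD _ _) _.
rewrite !mulrA; have : e = e / 2 + e / 2 by field.
lra.
Qed.

(** * Effect of one push on the complex *)

Hypothesis X_sub : forall A B, X A -> B `<=` A -> X B.
Hypothesis act_neq0 : forall k S, S \in act k -> S != fset0.
Hypothesis act_uniq : forall k, uniq (act k).
Hypothesis act_single : forall k A S S', remaining k.+1 A ->
  S \in act k -> S' \in act k -> S `<=` A -> S' `<=` A -> S = S'.
Hypothesis act_cone : forall k A S, remaining k.+1 A -> S \in act k -> S `<=` A ->
  apex S \notin S /\ remaining k.+1 (apex S |` A).
Hypothesis act_locally_finite : forall v, exists N, forall k S A,
  (N <= k)%N -> S \in act k -> X A -> v \in A -> ~~ (S `<=` A).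

Lemma push0 k p : push k p 0 = p.
Proof. by apply: functional_extensionality => v; rewrite /push mul0r addr0. Qed.

Lemma min_on_off S A p : (forall v, 0 <= p v) -> (forall v, v \notin A -> p v = 0) ->
  ~~ (S `<=` A) -> min_on S p = 0.
Proof.
move=> p0 pA /fsubsetPn[v vS vA]; apply: le_anti.
by rewrite min_on_ge0 // andbT -(pA v vA) min_on_le.
Qed.

Lemma push_off k p t A : (forall v, 0 <= p v) -> (forall v, v \notin A -> p v = 0) ->
  (forall S, S \in act k -> ~~ (S `<=` A)) -> push k p t = p.
Proof.
move=> p0 pA off; apply: functional_extensionality => v.
rewrite /push big_seq big1 ?mulr0 ?addr0 // => S Sk.
by rewrite (min_on_off p0 pA (off S Sk)) mul0r.
Qed.

Lemma sum_fsub A B p : A `<=` B -> (forall v, v \notin A -> p v = 0) ->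
  \sum_(v <- B) p v = \sum_(v <- A) p v.
Proof.
move=> AB pA; rewrite (big_fsetID _ (mem A)) /= [X in _ + X]big1_seq ?addr0.
  by congr (\sum_(v <- enum_fset _) _); apply/fsetP => v; rewrite !inE andbC;
     case: (boolP (v \in A)) => // /(fsubsetP AB).
by move=> v; rewrite !inE => /andP[_ /andP[_ /pA]].
Qed.

Lemma point_le1 A p v : (forall v, v \notin A -> p v = 0) -> (forall v, 0 <= p v) ->
  \sum_(v <- A) p v = 1 -> p v <= 1.
Proof.
move=> pA p0 <-; have [vA|/pA ->] := boolP (v \in A); last exact: sumr_ge0.
by rewrite (big_fsetD1 v) //= lerDl sumr_ge0.
Qed.

(** By [act_single] at most one member of [act k] lies in the support, and by [act_cone] its apex
    may be adjoined to the support. *)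
Lemma push_point k p t : 0 <= t <= 1 -> point (remaining k.+1) p ->
  point (remaining k.+1) (push k p t) /\
  (t = 1 -> point (remaining k) (push k p t)).
Proof.
move=> /andP[t0 t1] [A [KA pA p0 p1]].
have [/hasP[S Sk SA]|/hasPn off] := boolP (has (fun S => S `<=` A) (act k)); last first.
  rewrite (push_off _ p0 pA) //; split; first by exists A.
  move=> _; exists A; split=> //; split; first by case: KA.
  move=> k' S; rewrite leq_eqVlt => /predU1P[<-|lt]; first exact: off.
  exact: KA.2.
have [wS KA'] := act_cone KA Sk SA; set w := apex S in wS KA'.
set m := min_on S p.
have pushE v : push k p t v = p v + t * m * spread S v.
  rewrite /push (bigD1_seq S) //= big_seq_cond big1 ?addr0 ?mulrA // => S' /andP[S'k S'S].
  rewrite (min_on_off p0 pA) ?mul0r //; apply: contraNN S'S => S'A.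
  by rewrite (act_single KA S'k Sk S'A SA).
have m0 : 0 <= m by exact: min_on_ge0.
have le_p v : v \in S -> t * m <= p v.
  by move=> vS; apply: le_trans (min_on_le p vS); rewrite ler_piMl.
have push_supp v : v \notin w |` A -> push k p t v = 0.
  rewrite !inE negb_or => /andP[vw vA]; rewrite pushE pA // /spread (negPf vw).
  by rewrite (contraNF (fsubsetP SA v) vA) mulr0 subr0 mulr0 addr0.
have push_ge0 v : 0 <= push k p t v.
  rewrite pushE /spread; have [vS|vS] := boolP (v \in S).
    have -> : (v == w) = false by apply: contraNF wS => /eqP <-.
    by rewrite mulr0 sub0r mulrN1 subr_ge0 le_p.
  by rewrite subr0 addr_ge0 // !mulr_ge0.
have push_sum : \sum_(v <- w |` A) push k p t v = 1.
  rewrite (eq_bigr _ (fun v _ => pushE v)) big_split /= -mulr_sumr.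
  rewrite (@sum_fsub A) ?fsubsetU1 // p1 /spread big_split /= -mulr_sumr sumrN.
  rewrite (@sum_fsub [fset w]) ?fsub1set ?fset1U1 //; last first.
    by move=> v; rewrite inE => /negPf ->.
  rewrite big_seq_fset1 eqxx mulr1.
  rewrite (@sum_fsub S (w |` A) (fun v => (v \in S)%:R)); last first.
  - by move=> v /negPf ->.
  - exact: fsubset_trans SA (fsubsetU1 _ _).
  rewrite big_seq (eq_bigr (fun=> 1)) => [|v ->//].
  by rewrite -big_seq big_const_seq count_predT iter_addr_0 subrr mulr0 addr0.
split; first by exists (w |` A).
(* A vertex [a] attaining the minimum is emptied at [t = 1], so the new support no longer contains
   [S]. *)
move=> tE; have [|a aS ma] := min_on_attained (act_neq0 Sk) (p := p).
  by move=> v; apply: point_le1 pA p0 p1.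
have pa0 : push k p t a = 0.
  rewrite pushE /spread aS; have -> : (a == w) = false by apply: contraNF wS => /eqP <-.
  by rewrite mulr0 sub0r mulrN1 tE mul1r /m ma subrr.
have pA' v : v \notin (w |` A) `\ a -> push k p t v = 0.
  by rewrite !inE negb_and negbK => /orP[/eqP->//|vA]; apply: push_supp; rewrite !inE.
exists ((w |` A) `\ a); split=> //; last first.
  by rewrite -push_sum; apply/esym/sum_fsub => //; apply: fsubD1set.
split; first by apply: X_sub (fsubD1set _ a); case: KA'.
(* A member of [act k] inside the new support would be [S] by [act_single], but [S] contains [a]. *)
move=> k' S'; rewrite leq_eqVlt => /predU1P[<-|lt] S'k.
  apply/negP => S'A.
  have S'wA := fsubset_trans S'A (fsubD1set _ _).
  have SwA := fsubset_trans SA (fsubsetU1 w _).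
  move: S'A; rewrite (act_single KA' S'k Sk S'wA SwA) => /fsubsetP/(_ a aS).
  by rewrite !inE eqxx.
apply: contraNN (KA'.2 k' S' lt S'k) => S'A.
exact: fsubset_trans S'A (fsubD1set _ _).
Qed.

(* The [k]-th push takes place during the time interval [1/(k+2), 1/(k+1)]. *)
Definition clock (k : nat) t : R :=
  Num.min 1 (Num.max 0 (k.+1%:R * (k.+2%:R * t - 1))).

Lemma clock01 k t : 0 <= clock k t <= 1.
Proof. by rewrite /clock le_min ler01 le_max lexx ge_min lexx. Qed.

Lemma clock0 k : clock k 0 = 0.
Proof.
rewrite /clock; have k0 : 0 < k.+1%:R :> R by rewrite ltr0n.
have -> : Num.max 0 (k.+1%:R * (k.+2%:R * 0 - 1)) = 0 :> R by apply/max_idPl; lra.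
by apply/min_idPr.
Qed.

Lemma clock1 k : clock k 1 = 1.
Proof.
rewrite /clock; apply/min_idPl; rewrite le_max; apply/orP; right.
rewrite mulr1 -[k.+2%:R]natr1 addrK -natrM ler1n muln_gt0 //.
Qed.

(** The time intervals meet only at endpoints, and smaller indices come later. *)
Lemma clock_lt1 k j t : clock k t < 1 -> (j < k)%N -> clock j t = 0.
Proof.
rewrite /clock gt_min ltxx /= gt_max ltr01 /= => lt jk.
suff : j.+1%:R * (j.+2%:R * t - 1) <= 0.
  by move=> le; rewrite (max_idPl le); apply/min_idPr.
have k0 : 0 < k.+1%:R :> R by rewrite ltr0n.
have j0 : 0 < j.+1%:R :> R by rewrite ltr0n.
have kt : k.+1%:R * t < 1.
  have k2 : 0 < k.+2%:R :> R by rewrite ltr0n.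
  rewrite -(ltr_pM2l k2) mulr1; move: lt; rewrite -[k.+2%:R]natr1; lra.
rewrite pmulr_rle0 // subr_le0.
have [t0|t0] := leP t 0; first by apply: le_trans ler01; rewrite pmulr_rle0 // ltr0n.
apply: le_trans (ltW kt); rewrite ler_pM2r // ler_nat; exact: jk.
Qed.

Lemma clock_lipschitz k t u :
  `|clock k t - clock k u| <= k.+1%:R * k.+2%:R * `|t - u|.
Proof.
pose C : R := k.+1%:R * k.+2%:R; have C0 : 0 <= C by rewrite mulr_ge0 ?ler0n.
rewrite -/C.
have -> : C * `|t - u| = `|k.+1%:R * (k.+2%:R * t - 1) - k.+1%:R * (k.+2%:R * u - 1)|.
  by rewrite -[C in LHS]ger0_norm // -normrM; congr `|_|; rewrite /C; ring.
rewrite /clock; set x := _ * (_ * t - _); set y := _ * (_ * u - _).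
have [n1 n2] : x - y <= `|x - y| /\ y - x <= `|x - y|.
  by rewrite ler_norm distrC ler_norm.
rewrite ler_norml; apply/andP.
case: (leP 1 (Num.max 0 x)); case: (leP 1 (Num.max 0 y)); case: (leP 0 x);
  by case: (leP 0 y) => *; split; lra.
Qed.

(** * Composition of the pushes *)

Fixpoint flow (N : nat) p t : V -> R :=
  if N is k.+1 then flow k (push k p (clock k t)) t else p.

Lemma flow_continuous N p t : continuous_at (flow N) p t.
Proof.
elim: N p => [|k IH] p e e0 /=; first by exists e.
have [d1 d10 d1P] := IH (push k p (clock k t)) e e0.
have [d2 d20 d2P] := @push_continuous k p (clock k t) d1 d10.
have C0 : 0 < k.+1%:R * k.+2%:R :> R by rewrite mulr_gt0 ?ltr0n.
exists (Num.min d2 (Num.min d1 (d2 / (k.+1%:R * k.+2%:R)))).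
  by rewrite !lt_min d20 d10 divr_gt0.
move=> q u pq; rewrite !lt_min => /and3P[_ tu1 tu2]; apply: d1P => //.
apply: d2P.
  by move=> v; have := pq v; rewrite !lt_min => /and3P[].
apply: le_lt_trans (clock_lipschitz _ _ _) _.
by rewrite mulrC -ltr_pdivlMr.
Qed.

Lemma flow_id N p t : (forall k, (k < N)%N -> clock k t = 0) -> flow N p t = p.
Proof.
elim: N p => [|k IH] p ct //=; rewrite ct // push0.
by apply: IH => j jk; apply: ct; apply: ltnW.
Qed.

Lemma point_weaken (Y Y' : {fset V} -> Prop) p :
  (forall A, Y A -> Y' A) -> point Y p -> point Y' p.
Proof. by move=> YY' [A [YA pA p0 p1]]; exists A; split=> //; apply: YY'. Qed.

(** Each completed push leads to the next [remaining k]; at the first uncompleted one, [clock_lt1]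
    says that no later push has started. *)
Lemma flow_point N p t : 0 <= t <= 1 -> point (remaining N) p -> point X (flow N p t).
Proof.
move=> t01; elim: N p => [|k IH] p pK /=; first by apply: point_weaken pK => A [].
have [pk pk1] := push_point (clock01 k t) pK.
have [lt|ge] := ltP (clock k t) 1.
  rewrite (flow_id _ (fun j => clock_lt1 lt)).
  by apply: point_weaken pk => A [].
by apply/IH/pk1/le_anti; rewrite ge; case/andP: (clock01 k t) => _ ->.
Qed.

Lemma flow_end N p : point (remaining N) p -> point (remaining 0) (flow N p 1).
Proof.
elim: N p => [|k IH] p pK //=; rewrite clock1; apply: IH.
have t1 : 0 <= (1 : R) <= 1 by rewrite ler01 lexx.
by apply: (push_point t1 pK).2.
Qed.

(** This gives a meaning to the infinite composition: pushes of index at least [N] fix the points of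
    [remaining N]. *)
Lemma flow_stable N M p t : point (remaining N) p -> (N <= M)%N -> flow M p t = flow N p t.
Proof.
move=> [A [KA pA p0 _]]; elim: M => [|M IH]; first by rewrite leqn0 => /eqP->.
rewrite leq_eqVlt => /predU1P[<-//|NM] /=; rewrite (push_off _ p0 pA) ?IH //.
by move=> S; apply: KA.2.
Qed.

(** A vertex [v] with [p v > 0] is in the support of every [q] closer than [p v], and
    [act_locally_finite] gives one [N] for all simplices containing [v]. *)
Lemma remaining_near p : point X p -> exists N, exists2 d, 0 < d &
  forall q, point X q -> near_fun d p q -> point (remaining N) q.
Proof.
move=> [A [XA pA p0 p1]].
have [v pv] : exists v, 0 < p v.
  have [/hasP[v vA pv]|/hasPn le0] := boolP (has (fun v => 0 < p v) (enum_fset A)).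
    by exists v.
  have : \sum_(v <- A) p v <= 0.
    by rewrite big_seq; apply: sumr_le0 => v vA; have := le0 v vA; rewrite -leNgt.
  by rewrite p1 ler10.
have [N NP] := act_locally_finite v; exists N, (p v) => // q [B [XB qB q0 q1]] pq.
exists B; split=> //; split=> // k S Nk Sk.
apply: NP Nk Sk XB _; apply: contraTT (pq v) => /qB ->.
by rewrite subr0 ger0_norm // ltxx.
Qed.

Variable c : V.
Hypothesis X_c : X [fset c].
Hypothesis remaining0 : forall A, remaining 0 A -> A `<=` [fset c].

Theorem collapse_contraction :
  exists (H : (V -> R) -> R -> V -> R) (c0 : V -> R),
    [/\ point X c0,
        forall p t, point X p -> 0 <= t <= 1 -> point X (H p t),
        forall p, point X p -> H p 0 = p,
        forall p, point X p -> H p 1 = c0 &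
        forall p t, point X p -> 0 <= t <= 1 -> forall e, 0 < e ->
          exists2 d, 0 < d & forall q u, point X q -> 0 <= u <= 1 ->
            near_fun d p q -> `|t - u| < d -> near_fun e (H p t) (H q u)].
Proof.
(* The arbitrary choice does not affect continuity: by [HE] every admissible [N] gives the same
   flow, and one [N] is admissible near any given point. *)
pose depth p := ClassicalEpsilon.epsilon (inhabits 0%N) (fun N => point (remaining N) p).
have depthP p : point X p -> point (remaining (depth p)) p.
  move=> pX; apply: (ClassicalEpsilon.epsilon_spec (inhabits 0%N) (fun N => point (remaining N) p)).
  have [N [d d0 dP]] := remaining_near pX; exists N; apply: dP => // v.
  by rewrite subrr normr0.
have HE p t N : point X p -> point (remaining N) p -> flow (depth p) p t = flow N p t.
  move=> pX pN; have [le|/ltnW le] := leqP N (depth p).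
    by rewrite (flow_stable t pN le).
  by rewrite (flow_stable t (depthP p pX) le).
exists (fun p t => flow (depth p) p t), (fun v => (v == c)%:R); split.
- exists [fset c]; split=> // [v|]; first by rewrite inE => /negPf ->.
  by rewrite big_seq_fset1 /= eqxx.
- by move=> p t pX t01; apply: flow_point => //; apply: depthP.
- by move=> p pX; apply: flow_id => k _; apply: clock0.
- move=> p pX; have [A [KA pA p0 p1]] := flow_end (depthP p pX).
  have Ac := remaining0 KA.
  apply: functional_extensionality => v; have [->|vc] := eqVneq v c.
    by move: p1; rewrite -(sum_fsub Ac pA) big_seq_fset1.
  by apply: pA; apply: contraNN vc => /(fsubsetP Ac); rewrite inE.
- move=> p t pX t01 e e0; have [N [d1 d10 d1P]] := remaining_near pX.
  have [d2 d20 d2P] := @flow_continuous N p t e e0.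
  exists (Num.min d1 d2); first by rewrite lt_min d10.
  move=> q u qX u01 pq; rewrite lt_min => /andP[_ tu].
  have [pq1 pq2] : near_fun d1 p q /\ near_fun d2 p q.
    by split=> v; have := pq v; rewrite lt_min => /andP[].
  rewrite (HE q u N qX (d1P q qX pq1)) (HE p t N pX); first exact: d2P.
  by apply: d1P => // v; rewrite subrr normr0.
Qed.
End Collapse.

(** * The order of the collapses *)

Lemma leq_sum_prefix (F : nat -> nat) i j : (i <= j)%N ->
  (\sum_(k < i) F k <= \sum_(k < j) F k)%N.
Proof.
move=> ij; rewrite -!(big_mkord xpredT F) [X in (_ <= X)%N](big_cat_nat (leq0n i) ij) /=.
exact: leq_addr.
Qed.

Section Lattice.
Variables n r : nat.
Hypothesis n25 : (2 <= n <= 5)%N.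
Hypothesis nr : (n <= r)%N.
Implicit Types (v w : Zn n) (A S T : {fset Zn n}).

Definition box (j : nat) : {fset Zn n} :=
  [fset v in codom (fun g : {ffun 'I_n -> 'I_j.*2.+1} =>
                      [ffun l => (g l : nat)%:Z - j%:Z] : Zn n) | (stage v <= j)%N].

Lemma mem_box j v : (v \in box j) = (stage v <= j)%N.
Proof.
rewrite !inE /=; apply: andb_idl => vj; apply/codomP.
have vl l : (`|v l| <= j)%N.
  have := stage_ge v l; have : (0 < n)%N by lia.
  by rewrite /zigzag; nia.
exists [ffun l => inord `|(v l + j%:Z)%R|].
apply/ffunP => l; rewrite !ffunE; have vlj := vl l.
suff : v l = (inord `|(v l + j%:Z)%R| : 'I_j.*2.+1)%:Z - j%:Z :> int by [].
by rewrite inordK; lia.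
Qed.

Definition simplex A : Prop := forall v w, v \in A -> w \in A -> (l1dist v w <= r)%N.

Definition set_stage S : nat := (\max_(v <- S) stage v)%N.

(* Numbers the single-stage simplices increasingly in the stage, then in the
   cardinality; the simplices of one stage lie on one side of a coordinate box. *)
Definition level S : nat := (\sum_(j < set_stage S) #|` box j|.+1 + #|` S|)%N.

(** The bound [n] on the stage spares the origin, on which the complex is to collapse. *)
Definition removable S : bool :=
  [&& S != fset0, n <= set_stage S, all (fun v => stage v == set_stage S) S &
      all (fun v => all (fun w => l1dist v w <= r) S) S]%N.

Definition removable_at (k : nat) : seq {fset Zn n} :=
  [seq S <- fpowerset (box k) | removable S && (level S == k)].

Lemma removableP S j : S != fset0 -> (n <= j)%N -> (forall v, v \in S -> stage v = j) ->
  simplex S -> removable S /\ set_stage S = j.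
Proof.
move=> S0 nj Sj XS.
have st : set_stage S = j.
  apply/eqP; rewrite eqn_leq; apply/andP; split.
    by apply/bigmax_leqP_seq => v vS _; rewrite Sj.
  by have [v vS] := fset0Pn _ S0; rewrite -(Sj v vS); apply: leq_bigmax_seq.
split=> //; rewrite /removable S0 st nj /=; apply/andP; split.
  by apply/allP => v vS; rewrite Sj.
by apply/allP => v vS; apply/allP => w wS; apply: XS.
Qed.

Lemma removable_stage S v : removable S -> v \in S -> stage v = set_stage S.
Proof. by move=> /and4P[_ _ /allP Sj _] vS; apply/eqP/Sj. Qed.

Lemma removable_simplex S : removable S -> simplex S.
Proof. by move=> /and4P[_ _ _ /allP SX] v w vS wS; exact: (allP (SX v vS)). Qed.

(** A single-stage simplex lies in the box of its stage, so its cardinality stays below the summand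
    reserved for that stage. *)
Lemma level_lt S T : removable S -> (set_stage S < set_stage T)%N ->
  (level S < level T)%N.
Proof.
move=> rS lt; apply: leq_trans (leq_addr _ _).
apply: (@leq_trans (\sum_(j < (set_stage S).+1) #|` box j|.+1)%N); last first.
  exact: (leq_sum_prefix (fun j => #|` box j|.+1)).
rewrite big_ord_recr /= /level addnS ltnS leq_add2l; apply: fsubset_leq_card.
by apply/fsubsetP => v /(removable_stage rS); rewrite mem_box => ->.
Qed.

Lemma mem_removable_at k S : (S \in removable_at k) = removable S && (level S == k).
Proof.
rewrite mem_filter andbC; apply: andb_idl => /andP[rS /eqP <-].
rewrite fpowersetE; apply/fsubsetP => v /(removable_stage rS).
rewrite mem_box => ->; apply: leq_trans (leq_addr _ _).
rewrite -[X in (X <= _)%N](card_ord (set_stage S)) -sum1_card.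
exact: leq_sum.
Qed.

Definition apex_spec S w : Prop :=
  [/\ (stage w < set_stage S)%N, forall v, v \in S -> (l1dist w v <= r)%N &
      forall v, (stage v < set_stage S)%N ->
        (forall u, u \in S -> (l1dist v u <= r)%N) -> (l1dist v w <= r)%N].

Definition apex S : Zn n := ClassicalEpsilon.epsilon (inhabits [ffun=> 0]) (apex_spec S).

Lemma apexP S : removable S -> apex_spec S (apex S).
Proof.
move=> rS; apply: ClassicalEpsilon.epsilon_spec; have [S0 nS _ _] := and4P rS.
apply: (apex_exists n25 nr nS (s := enum_fset S)).
- apply: contraNN S0 => /eqP S0; apply/eqP/fsetP => v.
  by rewrite inE -[LHS]/(v \in enum_fset S) S0.
- by move=> v; apply: removable_stage.
- by move=> v w; apply: removable_simplex.
Qed.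

Lemma simplex_sub A S : simplex A -> S `<=` A -> simplex S.
Proof. by move=> XA /fsubsetP SA v w vS wS; apply: XA; apply: SA. Qed.

Let rem := remaining simplex removable_at.

Lemma remaining_level k A S : rem k A -> removable S -> S `<=` A -> (level S < k)%N.
Proof.
move=> [_ KA] rS SA; rewrite ltnNge; apply/negP => le.
by have /negP := KA _ S le ltac:(by rewrite mem_removable_at rS eqxx); apply.
Qed.

(** Otherwise the vertex [v] alone would be a removable simplex of higher level, already gone. *)
Lemma remaining_stage_le k A S v : rem k.+1 A -> removable S -> level S = k ->
  v \in A -> (stage v <= set_stage S)%N.
Proof.
move=> KA rS Sk vA; rewrite leqNgt; apply/negP => lt.
have [_ nS _ _] := and4P rS.
have [||||r1 st1] := @removableP [fset v] (stage v).
- by apply/fset0Pn; exists v; rewrite inE.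
- exact: leq_trans nS (ltnW lt).
- by move=> w; rewrite inE => /eqP->.
- by apply: (simplex_sub KA.1); rewrite fsub1set.
have := remaining_level KA r1; rewrite fsub1set vA ltnS => /(_ isT).
by rewrite leqNgt -Sk level_lt // st1.
Qed.

(** Otherwise adding [v] to [S] would give a removable simplex of level [k + 1], already gone:
    larger simplices of a stage go first. *)
Lemma remaining_same_stage k A S v : rem k.+1 A -> removable S -> level S = k ->
  S `<=` A -> v \in A -> stage v = set_stage S -> v \in S.
Proof.
move=> KA rS Sk SA vA vst; apply/negPn/negP => vS.
have [S0 nS _ _] := and4P rS.
have vSA : v |` S `<=` A by rewrite fsubUset fsub1set vA.
have [|||rT stT] := @removableP (v |` S) (set_stage S) _ nS.
- by apply/fset0Pn; exists v; rewrite !inE eqxx.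
- by move=> w; rewrite !inE => /orP[/eqP->//|]; apply: removable_stage.
- exact: simplex_sub KA.1 vSA.
have := remaining_level KA rT vSA.
by rewrite /level stT cardfsU1 vS -Sk /level add1n addnS ltnn.
Qed.

(** Equal levels force equal stages, and each of the two simplices consists of all vertices of [A]
    of that stage. *)
Lemma removable_single k A S T : rem k.+1 A ->
  S \in removable_at k -> T \in removable_at k -> S `<=` A -> T `<=` A -> S = T.
Proof.
move=> KA; rewrite !mem_removable_at => /andP[rS /eqP Sk] /andP[rT /eqP Tk] SA TA.
have st : set_stage S = set_stage T.
  case: (ltngtP (set_stage S) (set_stage T)) => // lt.
    by have := level_lt rS lt; rewrite Sk Tk ltnn.
  by have := level_lt rT lt; rewrite Sk Tk ltnn.
apply/eqP; rewrite eqEfsubset; apply/andP; split; apply/fsubsetP => v vS.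
  apply: (remaining_same_stage KA rT Tk TA); first exact: (fsubsetP SA).
  by rewrite -st; apply: removable_stage.
apply: (remaining_same_stage KA rS Sk SA); first exact: (fsubsetP TA).
by rewrite st; apply: removable_stage.
Qed.

(** Vertices of [A] outside [S] have smaller stage, so the cone property of the apex applies to
    them. A removed simplex reappearing in the cone would have the stage of [S], hence would avoid
    the apex and lie in [A] already. *)
Lemma removable_cone k A S : rem k.+1 A -> S \in removable_at k -> S `<=` A ->
  apex S \notin S /\ rem k.+1 (apex S |` A).
Proof.
move=> KA; rewrite mem_removable_at => /andP[rS /eqP Sk] SA.
have [wst wS wcone] := apexP rS; set w := apex S in wst wS wcone *.
have wNS : w \notin S.
  by apply/negP => /(removable_stage rS) E; rewrite E ltnn in wst.
have wA v : v \in A -> (l1dist v w <= r)%N.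
  move=> vA; have := remaining_stage_le KA rS Sk vA.
  rewrite leq_eqVlt => /predU1P[st|lt].
    by rewrite l1distC; apply: wS; apply: (remaining_same_stage KA rS Sk SA vA st).
  by apply: wcone => // u /(fsubsetP SA) uA; apply: KA.1.
split=> //; split.
  move=> u v; rewrite !inE => /predU1P[->|uA] /predU1P[->|vA].
  - by rewrite /l1dist big1 // => l _; rewrite subrr.
  - by rewrite l1distC; apply: wA.
  - exact: wA.
  - exact: KA.1.
move=> k' T kk'; rewrite mem_removable_at => /andP[rT /eqP Tk']; apply/negP => TwA.
have stT : set_stage T = set_stage S.
  apply/eqP; rewrite eqn_leq; apply/andP; split.
    have [v vT] := fset0Pn _ (proj1 (andP rT)).
    rewrite -(removable_stage rT vT).
    have := fsubsetP TwA v vT; rewrite !inE => /predU1P[->|]; first exact: ltnW.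
    exact: remaining_stage_le KA rS Sk.
  by rewrite leqNgt; apply/negP => /(level_lt rT); rewrite Sk Tk' ltnNge ltnW.
have TA : T `<=` A.
  apply/fsubsetP => v vT; have := fsubsetP TwA v vT; rewrite !inE => /predU1P[vw|//].
  by move: wst; rewrite -vw (removable_stage rT vT) stT ltnn.
have := remaining_level KA rT TA; rewrite Tk' ltnS => /(leq_trans kk').
by rewrite ltnn.
Qed.

Lemma removable_locally_finite v : exists N, forall k S A,
  (N <= k)%N -> S \in removable_at k -> simplex A -> v \in A -> ~~ (S `<=` A).
Proof.
(* Vertices sharing a simplex with [v] are within [r] of it, and the number of an integer is at most
   twice its absolute value; so [J] bounds their stages. *)
pose J := (n * (2 * (r + \sum_(l < n) `|v l|)) + n)%N.
exists (\sum_(j < J.+1) #|` box j|.+1).+1%N => k S A Nk.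
rewrite mem_removable_at => /andP[rS /eqP Sk] XA vA; apply/negP => SA.
have stJ : (set_stage S <= J)%N.
  have [u uS] := fset0Pn _ (proj1 (andP rS)); rewrite -(removable_stage rS uS).
  have uv := XA _ _ (fsubsetP SA u uS) vA.
  apply/bigmax_leqP => l _.
  have ul : (`|u l - v l| <= l1dist u v)%N by rewrite /l1dist (bigD1 l) //= leq_addr.
  have vl : (`|v l| <= \sum_(l < n) `|v l|)%N by rewrite (bigD1 l) //= leq_addr.
  apply: leq_add; last by rewrite ltnW.
  by rewrite leq_mul2l; apply/orP; right; rewrite /zigzag; move: vl ul uv;
    move: (\sum_(_ < n) _)%N (u l) (v l) (l1dist u v) => s x y d; lia.
have : (level S <= \sum_(j < J.+1) #|` box j|.+1)%N.
  apply: (@leq_trans (\sum_(j < (set_stage S).+1) #|` box j|.+1)%N).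
    rewrite big_ord_recr /= /level leq_add2l; apply: ltnW; rewrite ltnS.
    apply: fsubset_leq_card.
    by apply/fsubsetP => u /(removable_stage rS); rewrite mem_box => ->.
  exact: (leq_sum_prefix (fun j => #|` box j|.+1)).
by rewrite Sk leqNgt Nk.
Qed.

Lemma remaining0_origin A : rem 0 A -> A `<=` [fset [ffun=> 0]].
Proof.
move=> KA; apply/fsubsetP => v vA; rewrite inE; apply/negPn/negP => v0.
have [l vl] : exists l, v l != 0.
  apply/existsP; apply: contraNT v0; rewrite negb_exists => /forallP v0.
  by apply/eqP/ffunP => l; rewrite ffunE; apply/eqP/negPn/v0.
have [||||r1 _] := @removableP [fset v] (stage v).
- by apply/fset0Pn; exists v; rewrite inE.
- apply: leq_trans (stage_ge v l); apply: leq_trans (leq_addr _ _).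
  by rewrite leq_pmulr // /zigzag; move: vl; move: (v l) => x; lia.
- by move=> w; rewrite inE => /eqP->.
- by apply: (simplex_sub KA.1); rewrite fsub1set.
by have := remaining_level KA r1; rewrite fsub1set vA => /(_ isT).
Qed.

(** * Contraction of the Vietoris-Rips complex *)

Lemma VR_pointE (p : Zn n -> Rdefinitions.R) : VR_point r p <-> point simplex p.
Proof.
split=> [[s [[us sX] ps p0 p1]]|[A [XA pA p0 p1]]].
  exists [fset v in s]; split=> //.
  - by move=> v w; rewrite !inE; apply: sX.
  - by move=> v; rewrite inE; apply: ps.
  - rewrite -p1; apply: perm_big; apply: uniq_perm => // v.
    by rewrite -[LHS]/(v \in [fset v in s]) inE.
by exists (enum_fset A); split=> //; split=> //; apply: fset_uniq.
Qed.

Lemma VR_contraction : VR_contractible n r.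
Proof.
have X_sub A S : simplex A -> S `<=` A -> simplex S by exact: simplex_sub.
have act_neq0 k S : S \in removable_at k -> S != fset0.
  by rewrite mem_removable_at => /andP[/and4P[]].
have act_uniq k : uniq (removable_at k) by rewrite filter_uniq // fset_uniq.
have X_0 : simplex [fset [ffun=> 0]].
  move=> v w; rewrite !inE => /eqP-> /eqP->.
  by rewrite /l1dist big1 // => l _; rewrite subrr.
have [H [c [cP HP H0 H1 Hc]]] :=
  @collapse_contraction Rdefinitions.R (Zn n) simplex removable_at apex
    X_sub act_neq0 act_uniq removable_single removable_cone
    removable_locally_finite [ffun=> 0] X_0 remaining0_origin.
exists H, c; split.
- exact/VR_pointE.
- by move=> p t /VR_pointE pX t01; apply/VR_pointE/HP.
- by move=> p /VR_pointE; apply: H0.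
- by move=> p /VR_pointE; apply: H1.
- move=> p t /VR_pointE pX t01 e e0; have [d d0 dP] := Hc p t pX t01 e e0.
  by exists d => // q u /VR_pointE; apply: dP.
Qed.
End Lattice.

Theorem theorem3p12 (n r : nat) :
  (2 <= n)%N -> (n <= 5)%N -> (n <= r)%N -> VR_contractible n r.
Proof. by move=> n2 n5; apply: VR_contraction; rewrite n2. Qed.
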